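(* Let $\varphi:\mathbb{R}^n\to\overline{\mathbb{R}}$ be l.s.c. and subdifferentially continuous at $\bar x\in\operatorname{dom}\varphi$ for $\bar v\in\partial\varphi(\bar x)$. Then the following assertions are equivalent: (i) $\varphi$ is variationally strongly convex at $\bar x$ for $\bar v$ (with some modulus $\sigma>0$). (ii) $\varphi$ is prox-regular at $\bar x$ for $\bar v$ and the limiting second-order subdifferential is positive-definite in the sense that $$\langle z,w\rangle>0\quad\text{whenever } z\in\partial^2\varphi(\bar x,\bar v)(w),\ w\ne0.$$
   Context: Conventions: $\overline{\mathbb{R}}:=(-\infty,\infty]$; every extended-real-valued function is assumed proper, i.e. $\operatorname{dom}\varphi:=\{x\mid\varphi(x)<\infty\}\neq\emptyset$. $\mathbb{B}_\epsilon(a)$ is the closed ball with center $a$ and radius $\epsilon$; l.s.c. means lower semicontinuous. Subdifferentials: for $\bar x\in\operatorname{dom}\varphi$, the regular subdifferential is $$\widehat\partial\varphi(\bar x)=\Big\{v\in\mathbb{R}^n\;\Big|\;\liminf_{x\to\bar x}\frac{\varphi(x)-\varphi(\bar x)-\langle v,x-\bar x\rangle}{\|x-\bar x\|}\ge 0\Big\},$$ and the limiting subdifferential $\partial\varphi(\bar x)$ is the set of all $v$ for which there are $x_k\to\bar x$ with $\varphi(x_k)\to\varphi(\bar x)$ and $v_k\in\widehat\partial\varphi(x_k)$ with $v_k\to v$. For a set $\Omega$ with indicator function $\delta_\Omega$ ($0$ on $\Omega$, $\infty$ off $\Omega$) the limiting normal cone at $\bar x\in\Omega$ is $N_\Omega(\bar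 x):=\partial\delta_\Omega(\bar x)$. Limiting second-order subdifferential: for $(x,y)\in\operatorname{gph}\partial\varphi$ and $w\in\mathbb{R}^n$, $\partial^2\varphi(x,y)(w):=\{z\mid(z,-w)\in N_{\operatorname{gph}\partial\varphi}(x,y)\}$. Variational strong convexity: an l.s.c. function $\varphi$ is variationally strongly convex at $\bar x$ for $\bar v\in\partial\varphi(\bar x)$ with modulus $\sigma>0$ if for some convex neighborhood $U\times V$ of $(\bar x,\bar v)$ there exist an l.s.c. function $\psi\le\varphi$ on $U$ that is strongly convex on $U$ with modulus $\sigma$ (i.e. $\psi-\frac\sigma2\|\cdot\|^2$ is convex on $U$) and a number $\epsilon>0$ such that $$(U_\epsilon\times V)\cap\operatorname{gph}\partial\varphi=(U\times V)\cap\operatorname{gph}\partial\psi\quad\text{and}\quad\varphi(x)=\psi(x)\ \text{at the common elements }(x,v),$$ where $U_\epsilon:=\{x\in U\mid\varphi(x)<\varphi(\bar x)+\epsilon\}$. Prox-regularity: an l.s.c. function $\varphi$ is prox-regular at $\bar x\in\operatorname{dom}\varphi$ for $\bar v\in\partial\varphi(\bar x)$ if there exist $\epsilon>0$ and $r\ge0$ such that $\varphi(x)\ge\varphi(u)+\langle v,x-u\rangle-\frac r2\|x-u\|^2$ for all $x\in\mathbb{B}_\epsilon(\bar x)$ and all $(u,v)\in\operatorname{gph}\partial\varphi\cap(\mathbb{B}_\epsilon(\bar x)\times\mathbb{B}_\epsilon(\bar v))$ with $\varphi(u)<\varphi(\bar x)+\epsilon$. Subdifferential continuity: $\varphi$ is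 subdifferentially continuous at $\bar x$ for $\bar v\in\partial\varphi(\bar x)$ if for every $\epsilon>0$ there is $\delta>0$ such that $|\varphi(x)-\varphi(\bar x)|<\epsilon$ whenever $(x,v)\in\operatorname{gph}\partial\varphi\cap(\mathbb{B}_\delta(\bar x)\times\mathbb{B}_\delta(\bar v))$. *)

(* Defs.v *)
From HB Require Import structures.
From mathcomp Require Import all_boot all_order all_algebra.
From mathcomp Require Import all_classical all_reals all_analysis.

Set Implicit Arguments.
Unset Strict Implicit.
Unset Printing Implicit Defensive.

Import Order.TTheory GRing.Theory Num.Theory.
Import numFieldNormedType.Exports.

Local Open Scope classical_set_scope.
Local Open Scope ring_scope.

(* R^n is 'rV[R]_n.  The library norm `|x| on 'rV[R]_n is the sup norm, so the
   Euclidean inner product and norm are defined here.  Both norms induce the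
   library topology, which is the one used for limits and neighborhoods. *)

Definition dotv (R : realType) (n : nat) (u v : 'rV[R]_n) : R :=
  \sum_(i < n) u 0 i * v 0 i.

Definition enorm (R : realType) (n : nat) (u : 'rV[R]_n) : R :=
  Num.sqrt (dotv u u).

Definition ecball (R : realType) (n : nat) (a : 'rV[R]_n) (eps : R) :
    set 'rV[R]_n :=
  [set x | enorm (x - a) <= eps].

Definition edom (R : realType) (n : nat) (phi : 'rV[R]_n -> \bar R) :
    set 'rV[R]_n :=
  [set x | (phi x < +oo)%E].

(* Functions into (-oo, +oo] are functions into \bar R that avoid -oo. *)
Definition eproper (R : realType) (n : nat) (phi : 'rV[R]_n -> \bar R) : Prop :=
  (forall x, phi x != -oo%E) /\ edom phi !=set0.

(* Regular subdifferential; x^' is the punctured neighborhood filter of x.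
   It is empty outside the domain. *)
Definition regular_subdiff (R : realType) (n : nat)
    (phi : 'rV[R]_n -> \bar R) (x : 'rV[R]_n) : set 'rV[R]_n :=
  [set v | edom phi x /\
    (0 <= limf_einf
            (fun u => (phi u - phi x - (dotv v (u - x))%:E)
                      * ((enorm (u - x))^-1)%:E)
            x^')%E].

Definition limiting_subdiff (R : realType) (n : nat)
    (phi : 'rV[R]_n -> \bar R) (x : 'rV[R]_n) : set 'rV[R]_n :=
  [set v | edom phi x /\
    exists (x_ v_ : nat -> 'rV[R]_n),
      [/\ x_ @ \oo --> x,
          (fun k => phi (x_ k)) @ \oo --> phi x,
          (forall k, regular_subdiff phi (x_ k) (v_ k)) &
          v_ @ \oo --> v]].

Definition gph (X Y : Type) (F : X -> set Y) : set (X * Y) :=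
  [set p | F p.1 p.2].

Definition indicator_fun (R : realType) (n : nat) (Omega : set 'rV[R]_n)
    (x : 'rV[R]_n) : \bar R :=
  if x \in Omega then 0%E else +oo%E.

Definition limiting_normal (R : realType) (n : nat) (Omega : set 'rV[R]_n)
    (x : 'rV[R]_n) : set 'rV[R]_n :=
  limiting_subdiff (indicator_fun Omega) x.

(* R^n x R^n is identified with R^(n + n) through row_mx, so that its
   Euclidean structure is again the one of 'rV. *)
Definition second_subdiff (R : realType) (n : nat)
    (phi : 'rV[R]_n -> \bar R) (x y w : 'rV[R]_n) : set 'rV[R]_n :=
  [set z | limiting_normal
             [set row_mx p.1 p.2 | p in gph (limiting_subdiff phi)]
             (row_mx x y) (row_mx z (- w))].

Definition econvex_on (R : realType) (n : nat) (U : set 'rV[R]_n)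
    (f : 'rV[R]_n -> \bar R) : Prop :=
  forall (x y : 'rV[R]_n) (t : R), U x -> U y -> 0 < t -> t < 1 ->
    (f (t *: x + (1 - t) *: y)%R <= t%:E * f x + (1 - t)%:E * f y)%E.

Definition strongly_convex_on (R : realType) (n : nat) (U : set 'rV[R]_n)
    (sigma : R) (f : 'rV[R]_n -> \bar R) : Prop :=
  econvex_on U (fun x => f x - (sigma / 2 * enorm x ^+ 2)%:E)%E.

Definition variationally_strongly_convex (R : realType) (n : nat)
    (phi : 'rV[R]_n -> \bar R) (xbar vbar : 'rV[R]_n) (sigma : R) : Prop :=
  exists U V : set 'rV[R]_n,
    [/\ nbhs xbar U, nbhs vbar V, convex_set U & convex_set V] /\
  exists (psi : 'rV[R]_n -> \bar R) (eps : R),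
    let Ueps := [set x | U x /\ (phi x < phi xbar + eps%:E)%E] in
    [/\ eproper psi, lower_semicontinuous psi,
        (forall x, U x -> (psi x <= phi x)%E) &
        strongly_convex_on U sigma psi] /\
    [/\ 0 < eps,
        (Ueps `*` V) `&` gph (limiting_subdiff phi)
          = (U `*` V) `&` gph (limiting_subdiff psi) &
        (forall x v, ((Ueps `*` V) `&` gph (limiting_subdiff phi)) (x, v) ->
           phi x = psi x)].

Definition prox_regular (R : realType) (n : nat)
    (phi : 'rV[R]_n -> \bar R) (xbar vbar : 'rV[R]_n) : Prop :=
  exists eps r : R, [/\ 0 < eps, 0 <= r &
    forall x u v : 'rV[R]_n,
      ecball xbar eps x ->
      (gph (limiting_subdiff phi) `&` (ecball xbar eps `*` ecball vbar eps))
        (u, v) ->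
      (phi u < phi xbar + eps%:E)%E ->
      (phi u + (dotv v (x - u))%:E - (r / 2 * enorm (x - u) ^+ 2)%:E
         <= phi x)%E].

Definition subdiff_continuous (R : realType) (n : nat)
    (phi : 'rV[R]_n -> \bar R) (xbar vbar : 'rV[R]_n) : Prop :=
  forall eps : R, 0 < eps -> exists2 delta : R, 0 < delta &
    forall x v : 'rV[R]_n,
      (gph (limiting_subdiff phi) `&` (ecball xbar delta `*` ecball vbar delta))
        (x, v) ->
      (`|phi x - phi xbar| < eps%:E)%E.

(* Main.v *)
(** (i) => (ii). Near (xbar, vbar) the graph of the subdifferential of phi is that
    of psi, which is strongly monotone and, by minimizing psi - <v', .> over a ball,
    hits every v' near vbar. Testing a regular normal (z, -w) along such graph points
    gives sigma |w|^2 <= <z, w>, and the bound passes to limiting normals.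

    (ii) => (i). By prox-regularity, y = mu u + v with mu = r + 1 parametrizes the
    graph: u = P y is 1-Lipschitz, and v = Q y := y - mu P y is Lipschitz. Proximal
    subgradients z of y |-> <D, Q y> are bounded and give the normals (mu z, z - D),
    so by compactness positive definiteness yields <z, D> >= c |D|^2 near the base
    point, and a mean value inequality makes Q strongly monotone. Since Q is, up to
    scaling, the gradient of the Moreau envelope of phi, the envelope is strongly
    convex; translating its lower bound back gives
    phi x >= phi u + <v, x - u> + c mu / 2 |x - u|^2 at all nearby graph points (u, v).
    The supremum psi of these quadratics witnesses variational strong convexity. *)

Require Import Defs.
From mathcomp Require Import all_boot all_order all_algebra.
From mathcomp Require Import all_classical all_reals all_analysis.
From mathcomp Require Import ring lra.
Import Order.TTheory GRing.Theory Num.Theory.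
Import numFieldNormedType.Exports.
Local Open Scope classical_set_scope.
Local Open Scope ring_scope.

Set Implicit Arguments.
Unset Strict Implicit.

(** * Euclidean structure *)

Section Euclidean.
Context {R : realType} {n : nat}.
Implicit Types (u v w x y : 'rV[R]_n) (a : R).

Lemma dotvC u v : dotv u v = dotv v u.
Proof. by apply: eq_bigr => i _; rewrite mulrC. Qed.

Lemma dotvDl u v w : dotv (u + v) w = dotv u w + dotv v w.
Proof. by rewrite -big_split; apply: eq_bigr => i _; rewrite mxE mulrDl. Qed.

Lemma dotvZl a u v : dotv (a *: u) v = a * dotv u v.
Proof. by rewrite /dotv mulr_sumr; apply: eq_bigr => i _; rewrite mxE mulrA. Qed.

Lemma dotvNl u v : dotv (- u) v = - dotv u v.
Proof. by rewrite -scaleN1r dotvZl mulN1r. Qed.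

Lemma dotv0l v : dotv 0 v = 0.
Proof. by rewrite -[0](scale0r v) dotvZl mul0r. Qed.

Lemma dotvDr u v w : dotv w (u + v) = dotv w u + dotv w v.
Proof. by rewrite dotvC dotvDl !(dotvC w). Qed.

Lemma dotvZr a u v : dotv u (a *: v) = a * dotv u v.
Proof. by rewrite dotvC dotvZl dotvC. Qed.

Lemma dotvNr u v : dotv u (- v) = - dotv u v.
Proof. by rewrite dotvC dotvNl dotvC. Qed.

Lemma dotv0r v : dotv v 0 = 0.
Proof. by rewrite dotvC dotv0l. Qed.

Definition dotvE :=
  (dotvDl, dotvDr, dotvNl, dotvNr, dotvZl, dotvZr, dotv0l, dotv0r).

Lemma dotvv_ge0 u : 0 <= dotv u u.
Proof. by apply: sumr_ge0 => i _; rewrite -expr2 sqr_ge0. Qed.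

Lemma dotvv_eq0 u : dotv u u = 0 -> u = 0.
Proof.
move/eqP; rewrite psumr_eq0 => [/allP u0|i _]; last by rewrite -expr2 sqr_ge0.
apply/rowP => i; rewrite mxE; apply/eqP.
by have := u0 i (mem_index_enum _); rewrite mulf_eq0 orbb.
Qed.

Lemma enorm_ge0 u : 0 <= enorm u.
Proof. exact: sqrtr_ge0. Qed.

Lemma enorm_sqr u : enorm u ^+ 2 = dotv u u.
Proof. by rewrite sqr_sqrtr// dotvv_ge0. Qed.

Lemma enorm_eq0 u : enorm u = 0 -> u = 0.
Proof. by move=> u0; apply: dotvv_eq0; rewrite -enorm_sqr u0 expr0n. Qed.

Lemma enorm0 : enorm (0 : 'rV[R]_n) = 0.
Proof. by rewrite /enorm dotv0l sqrtr0. Qed.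

Lemma enorm_gt0 u : u != 0 -> 0 < enorm u.
Proof. by rewrite lt_def enorm_ge0 andbT; apply: contraNneq => /enorm_eq0->. Qed.

Lemma enormZ a u : enorm (a *: u) = `|a| * enorm u.
Proof. by rewrite /enorm dotvZl dotvZr mulrA -expr2 sqrtrM ?sqr_ge0// sqrtr_sqr. Qed.

Lemma enormN u : enorm (- u) = enorm u.
Proof. by rewrite /enorm dotvNl dotvNr opprK. Qed.

Lemma enormBC u v : enorm (u - v) = enorm (v - u).
Proof. by rewrite -opprB enormN. Qed.

(** Cauchy-Schwarz, from the nonnegativity of the squared norm of [|v|^2 u - <u, v> v]. *)
Lemma dotv_le u v : dotv u v <= enorm u * enorm v.
Proof.
have [->|v0] := eqVneq v 0; first by rewrite dotv0r enorm0 mulr0.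
have vp := enorm_gt0 v0.
have := dotvv_ge0 (enorm v ^+ 2 *: u - dotv u v *: v).
rewrite !dotvE (dotvC v u) -!enorm_sqr => h.
have h2 : dotv u v ^+ 2 <= (enorm u * enorm v) ^+ 2.
  have p : 0 < enorm v ^+ 2 by rewrite exprn_gt0.
  rewrite -(ler_pM2l p); nra.
have p := mulr_ge0 (enorm_ge0 u) (enorm_ge0 v).
by apply: le_trans (ler_norm _) _; rewrite -(@ler_pXn2r _ 2)// ?nnegrE// real_normK ?num_real.
Qed.

Lemma dotv_ge u v : - (enorm u * enorm v) <= dotv u v.
Proof. by have := dotv_le (- u) v; rewrite dotvNl enormN; lra. Qed.

Lemma enormD u v : enorm (u + v) <= enorm u + enorm v.
Proof.
rewrite -(@ler_pXn2r _ 2)// ?nnegrE ?addr_ge0 ?enorm_ge0//.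
rewrite enorm_sqr !dotvE (dotvC v u) -!enorm_sqr.
by have := dotv_le u v; nra.
Qed.

Lemma enormB u v : enorm (u - v) <= enorm u + enorm v.
Proof. by rewrite -(enormN v) enormD. Qed.

Lemma enorm_dist3 v u w : enorm (u - w) <= enorm (u - v) + enorm (v - w).
Proof. by rewrite -[u - w](subrKA v) enormD. Qed.

Lemma enorm_le u a : 0 <= a -> dotv u u <= a ^+ 2 -> enorm u <= a.
Proof.
by move=> a0 h; rewrite -(@ler_pXn2r _ 2)// ?nnegrE ?enorm_ge0// enorm_sqr.
Qed.

Lemma coord_le_enorm u i : `|u 0 i| <= enorm u.
Proof.
rewrite -(@ler_pXn2r _ 2)// ?nnegrE ?enorm_ge0// enorm_sqr real_normK ?num_real//.
rewrite /dotv (bigD1 i)//= -expr2 lerDl sumr_ge0// => j _.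
by rewrite -expr2 sqr_ge0.
Qed.

Lemma norm_le_enorm u : `|u| <= enorm u.
Proof.
rewrite /Num.norm/= mx_normrE; apply/bigmax_leP; split; first exact: enorm_ge0.
by move=> [i j] _ /=; rewrite ord1 coord_le_enorm.
Qed.

Lemma enorm_le_norm u : enorm u <= n%:R * `|u|.
Proof.
apply: enorm_le; first exact: mulr_ge0.
apply: (@le_trans _ _ (n%:R * `|u| ^+ 2)); last first.
  rewrite exprMn; apply: ler_wpM2r; first exact: sqr_ge0.
  by rewrite -natrX ler_nat; case: (n) => // k; rewrite -mulnn leq_pmulr.
have -> : n%:R * `|u| ^+ 2 = \sum_(i < n) `|u| ^+ 2.
  by rewrite sumr_const card_ord mulr_natl.
apply: ler_sum => i _.
rewrite -expr2 -(real_normK (num_real (u 0 i))) lerXn2r// ?nnegrE//.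
rewrite [leRHS]/Num.norm/= mx_normrE.
exact: (@le_bigmax _ _ _ 0 (fun ij => `|u ij.1 ij.2|) (0, i)).
Qed.

(** Since [|u| <= enorm u <= n |u|], library neighborhoods can be traded for open Euclidean balls;
    all later limit arguments go through this form. *)
Lemma nbhs_enormP x (A : set 'rV[R]_n) :
  nbhs x A <-> exists2 d : R, 0 < d & forall y, enorm (y - x) < d -> A y.
Proof.
split=> [/nbhs_ballP[d /= d0 xA]|[d d0 xA]].
  exists d => // y yx; apply: xA; rewrite -ball_normE/= distrC.
  exact: le_lt_trans (norm_le_enorm _) yx.
(* The factor [n.+1] replaces [n] so that the division stays legitimate in dimension 0. *)
have n0 : 0 < n.+1%:R :> R by rewrite ltr0Sn.
apply/nbhs_ballP; exists (d / n.+1%:R) => /=; first by rewrite divr_gt0.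
move=> y; rewrite -ball_normE/= distrC => yx; apply: xA.
apply: le_lt_trans (enorm_le_norm _) _.
move: yx; rewrite ltr_pdivlMr// mulrC; apply: le_lt_trans.
by apply: ler_wpM2r => //; rewrite ler_nat.
Qed.

Lemma cvg_enormP (x_ : nat -> 'rV[R]_n) x : x_ @ \oo --> x <->
  forall e : R, 0 < e -> exists N, forall k, (N <= k)%N -> enorm (x_ k - x) < e.
Proof.
split=> [xx e e0|h A /nbhs_enormP[d d0 dA]].
  have : nbhs x [set y | enorm (y - x) < e] by apply/nbhs_enormP; exists e.
  by move=> /xx [N _ hN]; exists N => k Nk; exact: hN.
by have [N hN] := h d d0; exists N => // k /= Nk; apply/dA/hN.
Qed.

Lemma nbhs_enorm_ball x (d : R) : 0 < d -> nbhs x [set y | enorm (y - x) < d].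
Proof. by move=> d0; apply/nbhs_enormP; exists d. Qed.

Lemma ecball_compact x (d : R) : compact (ecball x d).
Proof.
apply: bounded_closed_compact.
  exists (enorm x + d); split; first exact: num_real.
  move=> M hM y /= yd; apply: le_trans (norm_le_enorm _) _.
  have := enormD (y - x) x; rewrite subrK; move: yd hM; rewrite /ecball/=; lra.
move=> y yA; rewrite /ecball/= leNgt; apply/negP => dy.
have [|z [zA]] := yA [set z | enorm (z - y) < enorm (y - x) - d].
  by apply: nbhs_enorm_ball; rewrite subr_gt0.
move: zA; rewrite /ecball/= => zA zy.
by have := enorm_dist3 z y x; rewrite (enormBC y z); lra.
Qed.

End Euclidean.

Lemma dotv_row_mx {R : realType} {n m : nat} (a b : 'rV[R]_n) (c d : 'rV[R]_m) :
  dotv (row_mx a c) (row_mx b d) = dotv a b + dotv c d.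
Proof.
rewrite /dotv big_split_ord/=; congr (_ + _); apply: eq_bigr => i _.
  by rewrite !row_mxEl.
by rewrite !row_mxEr.
Qed.

Lemma enorm_row_mx {R : realType} {n m : nat} (a : 'rV[R]_n) (b : 'rV[R]_m) :
  [/\ enorm a <= enorm (row_mx a b), enorm b <= enorm (row_mx a b) &
      enorm (row_mx a b) <= enorm a + enorm b].
Proof.
have a0 := enorm_ge0 a; have b0 := enorm_ge0 b.
split; apply: enorm_le; rewrite ?addr_ge0 ?enorm_ge0// ?enorm_sqr dotv_row_mx.
- by rewrite lerDl dotvv_ge0.
- by rewrite lerDr dotvv_ge0.
- by rewrite -!enorm_sqr; nra.
Qed.

(** * Subdifferentials and normals in epsilon-delta form *)

(** The sublevel sets [F <= F b] with [b] in [K] generate a proper filter on [K]. Lower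
    semicontinuity relative to [K] makes any cluster point of it a minimizer, so no infimum has to
    be handled. *)
Lemma lsc_compact_min {R : realType} {T : topologicalType} (K : set T) (F : T -> \bar R) :
  compact K -> K !=set0 ->
  (forall x (a : R), K x -> (a%:E < F x)%E ->
     exists2 V, nbhs x V & forall y, V y -> K y -> (a%:E < F y)%E) ->
  exists2 x, K x & forall y, K y -> (F x <= F y)%E.
Proof.
move=> cK [x0 Kx0] lF.
pose G := filter_from K (fun b => [set x | K x /\ (F x <= F b)%E]).
have GF : ProperFilter G.
  apply: filter_from_proper; last by move=> b Kb; exists b.
  apply: filter_from_filter; first by exists x0.
  move=> b c Kb Kc; have [bc|cb] := leP (F b) (F c).
    by exists b => // x [Kx xb]; split; split=> //; exact: le_trans xb bc.
  by exists c => // x [Kx xb]; split; split=> //; exact: le_trans xb (ltW cb).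
have [|x [Kx xG]] := cK G GF; first by exists x0 => // x [].
exists x => // b Kb; rewrite leNgt; apply/negP => bx.
have [a ba ax] : exists2 a : R, (F b <= a%:E)%E & (a%:E < F x)%E.
  case: (F b) bx => [r| |] bx; [by exists r|by rewrite ltNge leey in bx|].
  case: (F x) bx => [r| |] bx; last by [].
    by exists (r - 1); rewrite ?leNye ?lte_fin ?ltrBlDr ?ltrDl.
  by exists 0; rewrite ?ltry ?leNye.
have [V xV VF] := lF x a Kx ax.
have [y [[Ky yb] Vy]] := xG _ V (ex_intro2 _ _ b Kb (@subset_refl _ _)) xV.
by have := VF y Vy Ky; rewrite ltNge (le_trans yb).
Qed.

Section Subdifferential.
Context {R : realType} {n : nat}.
Implicit Types (phi : 'rV[R]_n -> \bar R) (u v x y : 'rV[R]_n).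

Lemma regular_subdiffP phi x v : (forall u, phi u != -oo%E) ->
  regular_subdiff phi x v <->
  edom phi x /\ forall e : R, 0 < e -> exists2 d : R, 0 < d &
    forall u, enorm (u - x) < d ->
      (phi x + (dotv v (u - x) - e * enorm (u - x))%:E <= phi u)%E.
Proof.
move=> phiN; rewrite /regular_subdiff/= limf_einfE.
split=> -[xdom h]; split=> //; have := phiN x; move: xdom h; rewrite /edom/=;
  case phix : (phi x) => [a| |]// _ h _.
- move=> e e0.
  have /ereal_sup_gt[_ [A xA <-] eA] := @lt_le_trans _ _ 0%E (- e)%:E _ ltac:(by rewrite lte_fin oppr_lt0) h.
  have /nbhs_enormP[d d0 dA] := xA; exists d => // u ud.
  have [->|ux] := eqVneq u x; first by rewrite phix subrr dotv0r enorm0 mulr0 subr0 adde0.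
  have up : 0 < enorm (u - x) by rewrite enorm_gt0// subr_eq0.
  have := lt_le_trans eA (ereal_inf_lbound (ex_intro2 _ _ u (dA u ud ux) erefl)).
  have := phiN u; case: (phi u) => [b| |]// _; last by rewrite leey.
  rewrite /= lte_fin lee_fin.
  by rewrite ltr_pdivlMr// => ?; lra.
- apply/lee_addgt0Pr => e e0; have [d d0 dh] := h e e0.
  rewrite -leeBlDr// sub0e; apply: le_ereal_sup_tmp.
  exists (ereal_inf [set ((phi u - a%:E - (dotv v (u - x))%:E) * (enorm (u - x))^-1%:E)%E |
                 u in [set u | enorm (u - x) < d /\ u != x]]).
    exists [set u | enorm (u - x) < d /\ u != x] => //.
    by apply/nbhs_enormP; exists d.
  apply: le_ereal_inf_tmp => _ /= [u [ud ux] <-].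
  have up : 0 < enorm (u - x) by rewrite enorm_gt0// subr_eq0.
  have := phiN u; have := dh u ud; case: (phi u) => [b| |]// + _; last first.
    by move=> _; rewrite /= gt0_mulye ?lte_fin ?invr_gt0// leey.
  rewrite /= !lee_fin ler_pdivlMr// => ?; lra.
Qed.

(** Sequences are replaced by one approximating pair at each scale [e]; conversely the scales
    [1 / (k + 1)] give the sequences. The two strict inequalities encode [|phi u - phi x| < e]
    without subtracting extended reals. *)
Lemma limiting_subdiffP phi x v : (forall u, phi u != -oo%E) ->
  limiting_subdiff phi x v <->
  edom phi x /\ forall e : R, 0 < e -> exists u w,
    [/\ enorm (u - x) < e, (phi u < phi x + e%:E)%E, (phi x < phi u + e%:E)%E,
        regular_subdiff phi u w & enorm (w - v) < e].
Proof.
move=> phiN; split=> -[xdom h]; split=> //; have := phiN x;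
    move: xdom h; rewrite /edom/=; case phix : (phi x) => [a| |]// _ h _.
- move=> e e0; have [x_ [v_ [/cvg_enormP/(_ e e0)[N1 h1]]]] := h.
  move=> /fine_cvgP[[N2 _ h2]] /cvgrPdist_lt/(_ e e0)[N3 _ h3] h4.
  move=> /cvg_enormP/(_ e e0)[N5 h5].
  pose k := (N1 + N2 + N3 + N5)%N.
  have k1 : (N1 <= k)%N by rewrite /k -!addnA leq_addr.
  have k2 : (N2 <= k)%N by rewrite /k -!addnA addnCA leq_addr.
  have k3 : (N3 <= k)%N by rewrite /k addnAC leq_addl.
  have k5 : (N5 <= k)%N by rewrite /k leq_addl.
  exists (x_ k), (v_ k); split; [exact: h1| | |exact: h4|exact: h5].
  + have := h3 k k3; rewrite -[in X in _ -> X](@fineK _ (phi (x_ k))) ?h2//.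
    by rewrite /= lte_fin distrC ltr_distl => /andP[].
  + have := h3 k k3; rewrite -[in X in _ -> X](@fineK _ (phi (x_ k))) ?h2//.
    by rewrite /= lte_fin ltr_distl => /andP[].
- have /choice[f hf] : forall k : nat, exists p : 'rV[R]_n * 'rV[R]_n,
    [/\ enorm (p.1 - x) < k.+1%:R^-1, (phi p.1 < a%:E + k.+1%:R^-1%:E)%E,
        (a%:E < phi p.1 + k.+1%:R^-1%:E)%E,
        regular_subdiff phi p.1 p.2 & enorm (p.2 - v) < k.+1%:R^-1].
    move=> k; have [|u [w huw]] := h k.+1%:R^-1; first by rewrite invr_gt0 ltr0Sn.
    by exists (u, w).
  have inv (e : R) : 0 < e -> exists N, forall k, (N <= k)%N -> k.+1%:R^-1 < e.
    move=> e0; have [N _ hN] := near_infty_natSinv_lt (PosNum e0).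
    by exists N => k /hN.
  exists (fst \o f), (snd \o f); split.
  + apply/cvg_enormP => e /inv[N hN]; exists N => k /hN; apply: lt_trans.
    by have [] := hf k.
  + have ffin k : phi (f k).1 \is a fin_num.
      have [_ h1 h2 _ _] := hf k; have := phiN (f k).1.
      by case: (phi _) h1 h2.
    apply/fine_cvgP; split; first by exists 0%N => // k _; exact: ffin.
    have q (e : R) : 0 < e -> exists N, forall k, (N <= k)%N -> `|a - fine (phi (f k).1)| < e.
      move=> /inv[N hN]; exists N => k /hN ke.
      have [_ h1 h2 _ _] := hf k; move: h1 h2; rewrite -(fineK (ffin k)) /=.
      rewrite -!EFinD !lte_fin ltr_distl; move: (k.+1%:R^-1) ke => d *.
      by apply/andP; split; lra.
    by apply/cvgrPdist_lt => e /q[N hN]; exists N.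
  + by move=> k; have [] := hf k.
  + apply/cvg_enormP => e /inv[N hN]; exists N => k /hN; apply: lt_trans.
    by have [] := hf k.
Qed.

End Subdifferential.

(** The common form of the passages to the limit below: an error linear in [e], whose coefficient
    [C] may have any sign, disappears. *)
Lemma le_of_forall_eps {R : realFieldType} (X Y C : R) :
  (forall e, 0 < e -> e < 1 -> X <= Y + e * C) -> X <= Y.
Proof.
move=> h; rewrite leNgt; apply/negP => YX.
have C1 : 0 < `|C| + 1 by rewrite ltr_wpDl.
have [e [e0 e1 eC]] : exists e : R, [/\ 0 < e, e < 1 & e * (`|C| + 1) < X - Y].
  exists (Num.min (2^-1) ((X - Y) / (`|C| + 1) / 2)); split.
  - by rewrite lt_min invr_gt0 ltr0n/= !divr_gt0 ?subr_gt0.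
  - by rewrite gt_min invf_lt1 ?ltr1n.
  - apply: (@le_lt_trans _ _ ((X - Y) / (`|C| + 1) / 2 * (`|C| + 1))).
      by rewrite ler_pM2r// ge_min lexx orbT.
    by rewrite mulrAC divfK ?gt_eqF// ltr_pdivrMr// ltr_pMr ?subr_gt0// ltr1n.
have := h e e0 e1; have := ler_norm C; nra.
Qed.

(** * Normals to sets, subgradients of strongly convex functions, tilted minimization *)

Section Subgradients.
Context {R : realType} {n : nat}.
Implicit Types (phi psi : 'rV[R]_n -> \bar R) (u v w x y : 'rV[R]_n).
Implicit Types (Omega U : set 'rV[R]_n).

Lemma indicator_neq_ninfty Omega x : indicator_fun Omega x != -oo%E.
Proof. by rewrite /indicator_fun; case: ifP. Qed.

Lemma regular_normalP Omega x v : regular_subdiff (indicator_fun Omega) x v <->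
  Omega x /\ forall e : R, 0 < e -> exists2 d : R, 0 < d &
    forall y, Omega y -> enorm (y - x) < d ->
      dotv v (y - x) <= e * enorm (y - x).
Proof.
rewrite regular_subdiffP; last exact: indicator_neq_ninfty.
rewrite /edom/=; split=> -[].
  rewrite {1}/indicator_fun; case: ifPn => //; rewrite inE => Ox _ h; split=> //.
  move=> e /h[d d0 hd]; exists d => // y Oy /hd.
  by rewrite /indicator_fun !mem_set// add0e lee_fin => ?; lra.
move=> Ox h; split; first by rewrite /indicator_fun mem_set// ltry.
move=> e /h[d d0 hd]; exists d => // y yx.
rewrite {1}/indicator_fun mem_set// add0e /indicator_fun.
by case: ifPn => [|_]; rewrite ?leey// inE => /hd/(_ yx); rewrite lee_fin => ?; lra.
Qed.

Lemma limiting_normalP Omega x v : limiting_normal Omega x v <->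
  Omega x /\ forall e : R, 0 < e -> exists u w,
    [/\ enorm (u - x) < e, regular_subdiff (indicator_fun Omega) u w &
        enorm (w - v) < e].
Proof.
(* Regular normals exist only at points of the set, where the indicator is 0, so the closeness of
   function values is automatic. *)
rewrite /limiting_normal limiting_subdiffP; last exact: indicator_neq_ninfty.
rewrite /edom/=; split=> -[].
  rewrite {1}/indicator_fun; case: ifPn => //; rewrite inE => Ox _ h; split=> //.
  by move=> e /h[u [w []]]; exists u, w.
move=> Ox h; split; first by rewrite /indicator_fun mem_set// ltry.
move=> e e0; have [u [w [h1 h2 h3]]] := h e e0.
have /regular_normalP[Ou _] := h2.
by exists u, w; split=> //; rewrite /indicator_fun !mem_set// add0e lte_fin.
Qed.

Lemma regular_limiting phi u v : (forall x, phi x != -oo%E) ->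
  regular_subdiff phi u v -> limiting_subdiff phi u v.
Proof.
move=> phiN huv; have /(regular_subdiffP _ _ phiN)[udom _] := huv.
apply/limiting_subdiffP => //; split=> // e e0; exists u, v.
rewrite !subrr !enorm0; split=> //; have := phiN u; move: udom; rewrite /edom/=;
  by case: (phi u) => // a _ _; rewrite -EFinD lte_fin ltrDl.
Qed.

(** At the point [u + t (x - u)] the regular subgradient inequality bounds [psi] from below and
    strong convexity bounds it from above. Dividing by [t] and letting [t] tend to 0 leaves the
    quadratic growth. *)
Lemma strong_regular_subgradient psi U (s : R) u v x :
  (forall x, psi x != -oo%E) -> 0 <= s -> strongly_convex_on U s psi ->
  U u -> U x -> regular_subdiff psi u v ->
  (psi u + (dotv v (x - u) + s / 2 * enorm (x - u) ^+ 2)%:E <= psi x)%E.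
Proof.
move=> psiN s0 cvx Uu Ux /(regular_subdiffP _ _ psiN)[+ h].
have := psiN u; have := psiN x; rewrite /edom/=.
case psix : (psi x) => [b| |]// _; last by rewrite leey.
case psiu : (psi u) => [a| |]// _ _; rewrite -EFinD lee_fin.
set D := x - u; have D0 := enorm_ge0 D.
apply: (@le_of_forall_eps _ _ _ (enorm D + s / 2 * enorm D ^+ 2)) => e e0 e1.
have [d d0 hd] := h e e0.
have D1 : 0 < enorm D + 1 by lra.
(* This gives [t < e] and [t |D| < d]; the added 1 covers [D = 0]. *)
pose t := Num.min e (d / (enorm D + 1)) / 2.
have m0 : 0 < Num.min e (d / (enorm D + 1)) by rewrite lt_min e0 divr_gt0.
have t0 : 0 < t by rewrite divr_gt0.
have te : t < e.
  by rewrite ltr_pdivrMr// gt_min; apply/orP; left; lra.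
have td : t * enorm D < d.
  apply: (@lt_le_trans _ _ (2 * t * (enorm D + 1))); first by nra.
  by rewrite -ler_pdivlMr// mulrC divfK// ge_min lexx orbT.
have xtE : t *: x + (1 - t) *: u - u = t *: D.
  by apply/rowP => i; rewrite /D !mxE; ring.
have := cvx x u t Ux Uu t0 (lt_trans te e1).
have := hd (t *: x + (1 - t) *: u).
rewrite xtE enormZ gtr0_norm// => /(_ td).
have := psiN (t *: x + (1 - t) *: u).
rewrite psix psiu; case: (psi _) => [c| |]//= _.
rewrite !lee_fin !enorm_sqr !dotvE (dotvC u x).
have := dotvv_ge0 (x - u); rewrite !dotvE (dotvC u x) => Q0 h1 h2.
rewrite -(ler_pM2l t0); have et0 : 0 <= e - t by lra.
have := mulr_ge0 (mulr_ge0 s0 (ltW t0)) (mulr_ge0 et0 Q0).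
nra.
Qed.

Lemma strong_limiting_subgradient psi U (s : R) u v x :
  (forall x, psi x != -oo%E) -> 0 <= s -> strongly_convex_on U s psi ->
  nbhs u U -> U x -> limiting_subdiff psi u v ->
  (psi u + (dotv v (x - u) + s / 2 * enorm (x - u) ^+ 2)%:E <= psi x)%E.
Proof.
move=> psiN s0 cvx /nbhs_enormP[d d0 dU] Ux /(limiting_subdiffP _ _ psiN)[+ h].
have := psiN u; have := psiN x; rewrite /edom/=.
case psix : (psi x) => [b| |]// _; last by rewrite leey.
case psiu : (psi u) => [a| |]// _ _; rewrite -EFinD lee_fin.
apply: (@le_of_forall_eps _ _ _
  (enorm (x - u) + 2 + enorm v + s * enorm (x - u))) => e e0 e1.
have [|u' [w [u1 + au' huw wv]]] := h (Num.min e d); first by rewrite lt_min e0.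
move: u1 wv; rewrite !lt_min => /andP[u1 u2] /andP[wv _] _.
have := strong_regular_subgradient psiN s0 cvx (dU _ u2) Ux huw.
have := psiN u'; move: au'; rewrite psiu psix; case: (psi u') => [c| |]//.
rewrite -!EFinD lte_fin lee_fin => ac _.
have {}ac : a <= c + e by apply: le_trans (ltW ac) _; rewrite lerD2l ge_min lexx.
have xu : enorm (x - u') <= enorm (x - u) + e.
  by have := enorm_dist3 u x u'; rewrite (enormBC u u'); lra.
have ux : enorm (x - u) <= enorm (x - u') + e.
  by have := enorm_dist3 u' x u; lra.
have := dotv_ge (w - v) (x - u'); have := dotv_ge v (u - u').
rewrite (enormBC u u') => h1 h2.
have E : dotv w (x - u') =
    dotv (w - v) (x - u') + dotv v (x - u) + dotv v (u - u').
  by rewrite !dotvE; ring.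
rewrite {}E.
have [n1 n2] := (enorm_ge0 v, enorm_ge0 (x - u')).
have n3 := enorm_ge0 (x - u).
have n4 : enorm v * enorm (u' - u) <= enorm v * e by rewrite ler_wpM2l// ltW.
have n5 : enorm (w - v) * enorm (x - u') <= e * (enorm (x - u) + 1).
  by apply: ler_pM => //; [exact: enorm_ge0|lra|lra].
(* Squaring [|x - u| - e <= |x - u'|] needs a nonnegative left side; when [|x - u| < e] the claimed
   lower bound is nonpositive anyway. *)
have n6 : s / 2 * (enorm (x - u) ^+ 2 - 2 * e * enorm (x - u)) <=
    s / 2 * enorm (x - u') ^+ 2.
  apply: ler_wpM2l; first by rewrite divr_ge0.
  have [ex|xe] := leP e (enorm (x - u)); last by nra.
  have h3 : 0 <= enorm (x - u') - (enorm (x - u) - e) by lra.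
  have h4 : 0 <= enorm (x - u') + (enorm (x - u) - e) by lra.
  by have := mulr_ge0 h3 h4; nra.
lra.
Qed.

(* The minimizer is interior because the growth at [xb] forces
   [(mu + m) / 2 * |u - xb|^2 <= <y - (mu xb + vb), u - xb>]. *)
Lemma tilt_solvable phi xb vb y (m mu rho : R) :
  (forall x, phi x != -oo%E) -> lower_semicontinuous phi -> edom phi xb ->
  0 <= mu -> 0 < mu + m ->
  (forall x, ecball xb rho x ->
    (phi xb + (dotv vb (x - xb) + m / 2 * enorm (x - xb) ^+ 2)%:E <= phi x)%E) ->
  2 * enorm (y - (mu *: xb + vb)) < (mu + m) * rho ->
  exists2 u, (mu + m) * enorm (u - xb) <= 2 * enorm (y - (mu *: xb + vb)) &
    limiting_subdiff phi u (y - mu *: u).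
Proof.
move=> phiN lsc xbdom mu0 mum grow yrho.
have rho0 : 0 < rho.
  by have := enorm_ge0 (y - (mu *: xb + vb)); nra.
(* The function to minimize is [phi + q]: the gradient of [q] at [u] is [mu u - y], so an interior
   minimizer has [y - mu u] as a subgradient of [phi]. *)
pose q x := mu / 2 * enorm x ^+ 2 - dotv y x.
have qE x z : q z = q x + dotv (mu *: x - y) (z - x) + mu / 2 * enorm (z - x) ^+ 2.
  by rewrite /q !enorm_sqr !dotvE (dotvC z x); field.
have [|x a _|u urho umin] := @lsc_compact_min R _ _ (fun x => phi x + (q x)%:E)%E
    (@ecball_compact _ _ xb rho).
- by exists xb; rewrite /ecball/= subrr enorm0 ltW.
- move=> ax; have [e e0 eax] : exists2 e, 0 < e & ((a - q x + e)%:E < phi x)%E.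
    have := phiN x; move: ax; case: (phi x) => [b| |]// ax _; last by exists 1; rewrite ?ltry.
    move: ax; rewrite -EFinD lte_fin => ax.
    exists ((b + q x - a) / 2); first by rewrite divr_gt0// subr_gt0.
    by rewrite lte_fin; lra.
  have [V /nbhs_enormP[d d0 dV] Vphi] := lsc _ _ eax.
  pose c := enorm (mu *: x - y) + 1.
  have c0 : 0 < c by rewrite ltr_wpDl// enorm_ge0.
  exists [set z | enorm (z - x) < Num.min d (e / c)].
    by apply: nbhs_enorm_ball; rewrite lt_min d0 divr_gt0.
  move=> z /=; rewrite lt_min ltr_pdivlMr// => /andP[/dV/Vphi zx1 zx2] _.
  have qz : q x - e <= q z.
    rewrite (qE x z).
    have := dotv_ge (mu *: x - y) (z - x); have := enorm_ge0 (z - x).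
    have := mulr_ge0 mu0 (sqr_ge0 (enorm (z - x))).
    by move: zx2; rewrite /c; nra.
  move: zx1; have := phiN z; case: (phi z) => [b| |]// _; last by rewrite !ltry.
  by rewrite -EFinD !lte_fin => ?; lra.
have := umin xb; rewrite /ecball/= subrr enorm0 => /(_ (ltW rho0)).
have := grow u urho; have := phiN u; move: xbdom; have := phiN xb; rewrite /edom/=.
case phixb : (phi xb) => [a| |]// _ _.
case phiu : (phi u) => [c| |]// _ g1 g2.
move: g1 g2; rewrite -!EFinD !lee_fin (qE xb u) => g1 g2.
have uxb : (mu + m) * enorm (u - xb) <= 2 * enorm (y - (mu *: xb + vb)).
  have [->|ux] := eqVneq u xb; first by rewrite subrr enorm0 mulr0 mulr_ge0// enorm_ge0.
  have up : 0 < enorm (u - xb) by rewrite enorm_gt0// subr_eq0.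
  have := dotv_le (y - (mu *: xb + vb)) (u - xb).
  have -> : dotv (y - (mu *: xb + vb)) (u - xb) =
      - dotv (mu *: xb - y) (u - xb) - dotv vb (u - xb) by rewrite !dotvE; ring.
  by move=> h; rewrite -(ler_pM2r up); lra.
have uint : enorm (u - xb) < rho by rewrite -(ltr_pM2l mum); exact: le_lt_trans yrho.
exists u => //; apply: regular_limiting => //; apply/regular_subdiffP => //.
rewrite /edom/= phiu ltry; split=> // e e0.
have m1 : 0 < mu + 1 by lra.
(* The first bound keeps [z] in the ball where [u] is minimal; the second gives
   [mu / 2 |z - u|^2 <= e |z - u|]. *)
exists (Num.min (rho - enorm (u - xb)) (e / (mu + 1))).
  by rewrite lt_min subr_gt0 uint divr_gt0.
move=> z; rewrite lt_min ltr_pdivlMr// => /andP[zu1 zu2].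
have {}zu1 : enorm (z - xb) <= rho by have := enorm_dist3 u z xb; lra.
have := umin z zu1.
have := phiN z; rewrite phiu; case: (phi z) => [b| |]// _; last by move=> _; rewrite leey.
rewrite -!EFinD !lee_fin (qE u z) => h.
have -> : dotv (y - mu *: u) (z - u) = - dotv (mu *: u - y) (z - u).
  by rewrite !dotvE; ring.
by have := enorm_ge0 (z - u); nra.
Qed.

End Subgradients.

(** * From variational strong convexity to second-order positivity *)

Section VariationalToSecondOrder.
Context {R : realType} {n : nat}.
Implicit Types (phi psi : 'rV[R]_n -> \bar R) (u v w x y z : 'rV[R]_n).

(* Test the normal against [v' = v - t c] with [c = w - z / (2 s)]: strong
   monotonicity puts [u' - u] in a ball of radius [t |c| / (2 s)] around
   [- t c / (2 s)], which forces [|c| <= |z| / (2 s)]. *)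
Lemma regular_coderivative_ge (F : 'rV[R]_n -> set 'rV[R]_n) u v z w (s d : R) :
  0 < s -> 0 < d ->
  (forall v', enorm (v' - v) < d -> exists2 u', F u' v' &
     s * enorm (u' - u) ^+ 2 <= dotv (v' - v) (u' - u)) ->
  regular_subdiff (indicator_fun [set row_mx p.1 p.2 | p in gph F])
    (row_mx u v) (row_mx z (- w)) ->
  s * dotv w w <= dotv z w.
Proof.
move=> s0 d0 surj /regular_normalP[_ normal].
pose c := w - (2 * s)^-1 *: z; set N := enorm c.
have N0 : 0 <= N := enorm_ge0 c.
have K0 : 0 < 1 + s^-1 by rewrite ltr_wpDr// invr_ge0 ltW.
(* This gives [|c| <= |z| / (2 s)]; expanding the square of [c = w - z / (2 s)] cancels the [|z|^2]
   terms and leaves [s |w|^2 <= <z, w>]. *)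
suff : N ^+ 2 <= enorm z / (2 * s) * N.
  move=> h; have {}h : N <= enorm z / (2 * s).
    have [->|n0] := eqVneq N 0; first by rewrite divr_ge0 ?enorm_ge0// mulr_ge0// ltW.
    by rewrite -(@ler_pM2r _ N) -?expr2// lt_def n0.
  have {}h : N ^+ 2 <= (enorm z / (2 * s)) ^+ 2.
    by rewrite lerXn2r// nnegrE divr_ge0 ?enorm_ge0// mulr_ge0// ltW.
  move: h; rewrite enorm_sqr exprMn enorm_sqr /c !dotvE (dotvC w z) => h.
  have {}h : dotv w w <= s^-1 * dotv z w.
    have e : (2 * s)^-1 = 2^-1 * s^-1 by rewrite invfM.
    by move: h; rewrite e; lra.
  by rewrite -(ler_pM2l (_ : 0 < s^-1)) ?invr_gt0// mulKf// gt_eqF.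
apply: (@le_of_forall_eps _ _ _ ((1 + s^-1) * N)) => e e0 _.
have [de de0 hde] := normal e e0.
have N1 : 0 < N + 1 by lra.
(* With [t |c| < m], the shifted [v'] stays within [d] of [v], and the graph displacement, at most
   [(1 + 1 / s) t |c|], stays below [de]. *)
pose m := Num.min d (de / (1 + s^-1)).
have m0 : 0 < m by rewrite lt_min d0 divr_gt0.
pose t := m / (N + 1).
have t0 : 0 < t by rewrite divr_gt0.
have tN : t * N < m by rewrite /t mulrAC ltr_pdivrMr// ltr_pM2l//; lra.
have vtc : v - t *: c - v = - (t *: c) by rewrite addrAC subrr add0r.
have := surj (v - t *: c); rewrite vtc enormN enormZ gtr0_norm// -/N.
move=> /(_ (lt_le_trans tN _))[|u' Fu' mono]; first by rewrite /m ge_min lexx.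
set D := u' - u in mono *.
have D0 := enorm_ge0 D.
have DN : enorm D <= s^-1 * (t * N).
  rewrite -(ler_pM2l s0) mulVKf ?gt_eqF//.
  have [->|dn] := eqVneq (enorm D) 0; first by rewrite mulr0 mulr_ge0// ltW.
  rewrite -(@ler_pM2r _ (enorm D)); last by rewrite lt_def dn.
  have := dotv_le (- (t *: c)) D; rewrite enormN enormZ gtr0_norm// -/N.
  by move: mono; rewrite expr2; lra.
have := hde (row_mx u' (v - t *: c)).
rewrite opp_row_mx add_row_mx vtc -/D.
have [_ _ nle] := enorm_row_mx D (- (t *: c)).
move: nle; rewrite enormN enormZ (gtr0_norm t0) -/N => nle.
have {}nle : enorm (row_mx D (- (t *: c))) <= (1 + s^-1) * (t * N) by lra.
have lt1 : enorm (row_mx D (- (t *: c))) < de.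
  apply: le_lt_trans nle _; rewrite mulrC -ltr_pdivlMr//.
  by apply: lt_le_trans tN _; rewrite /m ge_min lexx orbT.
move=> /(_ (ex_intro2 _ _ (u', v - t *: c) Fu' erefl) lt1).
rewrite dotv_row_mx => ineq.
have {ineq} : dotv z D + t * dotv w c <= e * ((1 + s^-1) * (t * N)).
  have := ler_wpM2l (ltW e0) nle; move: ineq; rewrite !dotvE; lra.
have wc : dotv w c = N ^+ 2 + (2 * s)^-1 * dotv z c.
  by rewrite enorm_sqr /c !dotvE (dotvC w z); ring.
clearbody c D; pose b := D + (t / (2 * s)) *: c.
have ts : 0 <= t / (2 * s) by apply: divr_ge0; [exact: ltW|apply: mulr_ge0 => //; exact: ltW].
(* Completing the square in [s |D|^2 <= - t <c, D>]. *)
have bN : enorm b <= t / (2 * s) * N.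
  apply: enorm_le; first exact: mulr_ge0.
  rewrite exprMn /b !dotvE -!enorm_sqr -/N (dotvC c D).
  move: mono; rewrite dotvNl dotvZl (dotvC c D) => mono.
  have : (t / s) * dotv D c <= - enorm D ^+ 2.
    by rewrite mulrAC ler_pdivrMr//; lra.
  have -> : t / (2 * s) = 2^-1 * (t / s) by rewrite invfM mulrCA.
  lra.
have zb : dotv z b = dotv z D + t * ((2 * s)^-1 * dotv z c).
  by rewrite /b !dotvE mulrA.
have := dotv_ge z b; have := ler_wpM2l (enorm_ge0 z) bN.
rewrite wc zb => h1 h2 h3.
rewrite -(ler_pM2l t0); lra.
Qed.

(** The sum of the two growth inequalities. The sign of [s] is free: a negative [s] covers the
    hypomonotonicity coming from prox-regularity. *)
Lemma subgradients_monotone phi u v u' v' (s : R) :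
  (forall x, phi x != -oo%E) -> edom phi u -> edom phi u' ->
  (phi u + (dotv v (u' - u) + s / 2 * enorm (u' - u) ^+ 2)%:E <= phi u')%E ->
  (phi u' + (dotv v' (u - u') + s / 2 * enorm (u - u') ^+ 2)%:E <= phi u)%E ->
  s * enorm (u' - u) ^+ 2 <= dotv (v' - v) (u' - u).
Proof.
move=> phiN; rewrite /edom/=; have := phiN u; have := phiN u'.
case: (phi u) (phi u') => [a| |] [b| |]//= _ _ _ _.
rewrite !lee_fin (enormBC u u') -(opprB u' u) dotvNr dotvDl dotvNl; lra.
Qed.

(** This discharges the level conditions [phi u < phi xb + e], present both in prox-regularity and
    in [Ueps], at all graph points near [(xb, vb)]. *)
Lemma subdiff_continuous_lt phi xb vb (e : R) :
  (forall x, phi x != -oo%E) -> edom phi xb -> subdiff_continuous phi xb vb ->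
  0 < e -> exists2 d : R, 0 < d & forall u v, limiting_subdiff phi u v ->
    enorm (u - xb) <= d -> enorm (v - vb) <= d -> (phi u < phi xb + e%:E)%E.
Proof.
move=> phiN xbdom cont e0; have [d d0 hd] := cont e e0; exists d => // u v huv u1 v1.
have := hd u v (conj huv (conj u1 v1)); have := huv.1; move: xbdom.
have := phiN u; have := phiN xb; rewrite /edom/=.
case: (phi xb) (phi u) => [a| |] [b| |]//= _ _ _ _.
by rewrite !lte_fin ltr_distl => /andP[_]; rewrite addrC.
Qed.

(** Limiting normals are limits of regular normals at nearby graph points, and both sides of the
    bound are continuous in [(z, w)]. *)
Lemma second_subdiff_ge phi xb vb z w (s : R) : 0 <= s ->
  (exists2 d : R, 0 < d & forall u v z' w',
    enorm (u - xb) < d -> enorm (v - vb) < d ->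
    regular_subdiff (indicator_fun [set row_mx p.1 p.2 | p in gph (limiting_subdiff phi)])
      (row_mx u v) (row_mx z' (- w')) -> s * dotv w' w' <= dotv z' w') ->
  second_subdiff phi xb vb w z -> s * dotv w w <= dotv z w.
Proof.
move=> s0 [d d0 hd] /limiting_normalP[_ lim].
apply: (@le_of_forall_eps _ _ _
  (enorm w + 1 + enorm z + 2 * s * enorm w)) => e e0 e1.
have [|p [q [pd pq qe]]] := lim (Num.min e d); first by rewrite lt_min e0.
have /regular_normalP[[[u v] _ /= pE] _] := pq.
move: pd qe; rewrite !lt_min => /andP[_ pd] /andP[qe _].
pose z' := lsubmx q; pose w' := - rsubmx q.
have qE : q = row_mx z' (- w') by rewrite /w' opprK hsubmxK.
clearbody z' w'.
move: pd; rewrite -pE opp_row_mx add_row_mx => pd.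
have [u1 v1 _] := enorm_row_mx (u - xb) (v - vb).
move: qe; rewrite qE opp_row_mx add_row_mx => qe.
have [z1 w1 _] := enorm_row_mx (z' - z) (- w' - - w).
move: w1; rewrite -opprD enormN => w1.
have := hd u v z' w' (le_lt_trans u1 pd) (le_lt_trans v1 pd).
rewrite -qE pE => /(_ pq) h.
have {}z1 : enorm (z' - z) <= e by lra.
have {}w1 : enorm (w' - w) <= e.
  by move: qe; rewrite -opprD => qe; lra.
have [zn wn] := (enorm_ge0 z, enorm_ge0 w).
have w'n : enorm w' <= enorm w + 1.
  by have := enormD (w' - w) w; rewrite subrK; lra.
have h1 : dotv (z' - z) w' <= e * (enorm w + 1).
  by apply: le_trans (dotv_le _ _) _; apply: ler_pM; rewrite ?enorm_ge0.
have h2 : dotv z (w' - w) <= enorm z * e.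
  by apply: le_trans (dotv_le _ _) _; apply: ler_wpM2l.
have h3 : - (e * enorm w) <= dotv (w' - w) w.
  apply: le_trans (dotv_ge _ _); rewrite lerN2.
  by apply: ler_wpM2r; rewrite ?enorm_ge0.
have h4 := mulr_ge0 s0 (dotvv_ge0 (w' - w)).
have h5 := ler_wpM2l s0 h3.
move: h h1 h2 h4 h5; rewrite !dotvE (dotvC w w'); lra.
Qed.

Lemma variational_second_order phi xb vb (s : R) :
  eproper phi -> edom phi xb -> limiting_subdiff phi xb vb ->
  subdiff_continuous phi xb vb -> 0 < s ->
  variationally_strongly_convex phi xb vb s ->
  prox_regular phi xb vb /\
  forall z w, second_subdiff phi xb vb w z -> s * dotv w w <= dotv z w.
Proof.
move=> [phiN _] xbdom hvb cont s0 [U [V [[xU vV _ _] [psi [eps]]]]] /=.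
move=> [[[psiN _] psilsc psile cvx] [eps0 eqg eqv]].
have [d1 d10 xd1] := (nbhs_enormP _ _).1 xU.
have [d2 d20 vd2] := (nbhs_enormP _ _).1 vV.
pose rho := Num.min d1 d2; have rho0 : 0 < rho by rewrite lt_min d10.
have inU u : enorm (u - xb) < rho -> U u by rewrite lt_min => /andP[/xd1].
have inV v : enorm (v - vb) < rho -> V v by rewrite lt_min => /andP[_ /vd2].
have nbU u : enorm (u - xb) < rho -> nbhs u U.
  move=> ur; apply/nbhs_enormP; exists (rho - enorm (u - xb)); first by rewrite subr_gt0.
  by move=> y yu; apply: inU; have := enorm_dist3 u y xb; lra.
have toPsi u v : enorm (u - xb) < rho -> enorm (v - vb) < rho ->
    (phi u < phi xb + eps%:E)%E -> limiting_subdiff phi u v ->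
    limiting_subdiff psi u v /\ phi u = psi u.
  move=> ur vr ue huv; pose A := [set x | U x /\ (phi x < phi xb + eps%:E)%E].
  have uvA : ((A `*` V) `&` gph (limiting_subdiff phi)) (u, v).
    by split=> //; split; [split; first exact: inU|exact: inV].
  split; last exact: eqv uvA.
  by move: uvA; rewrite eqg => -[].
have toPhi u v : enorm (u - xb) < rho -> enorm (v - vb) < rho ->
    limiting_subdiff psi u v -> limiting_subdiff phi u v.
  move=> ur vr huv.
  have : ((U `*` V) `&` gph (limiting_subdiff psi)) (u, v).
    by split=> //; split; [exact: inU|exact: inV].
  by rewrite -eqg => -[].
have grow u v x : enorm (u - xb) < rho -> limiting_subdiff psi u v -> U x ->
    (psi u + (dotv v (x - u) + s / 2 * enorm (x - u) ^+ 2)%:E <= psi x)%E.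
  by move=> ur huv Ux; apply: strong_limiting_subgradient (ltW s0) cvx (nbU _ ur) Ux huv.
have xblt : (phi xb < phi xb + eps%:E)%E.
  have := phiN xb; move: xbdom; rewrite /edom/=.
  by case: (phi xb) => // a _ _; rewrite -EFinD lte_fin ltrDl.
have xbr : enorm (xb - xb) < rho by rewrite subrr enorm0.
have vbr : enorm (vb - vb) < rho by rewrite subrr enorm0.
have [hvbpsi xbE] := toPsi _ _ xbr vbr xblt hvb.
split.
  (* The constant [r = 0] suffices, since the growth of [psi] adds a nonnegative quadratic term.
     Halving [rho] turns closed balls into strict bounds. *)
  exists (Num.min (rho / 2) eps), 0; split=> //; first by rewrite lt_min eps0 divr_gt0.
  move=> x u v; rewrite /ecball/= !le_min => /andP[xr _] [huv [/andP[ur _] /andP[vr _]]] ue.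
  have half a : a <= rho / 2 -> a < rho by lra.
  have {}ue : (phi u < phi xb + eps%:E)%E.
    by apply: lt_le_trans ue _; rewrite leeD2l// lee_fin ge_min lexx orbT.
  have [huvpsi uE] := toPsi _ _ (half _ ur) (half _ vr) ue huv.
  have Ux := inU _ (half _ xr).
  apply: le_trans (psile _ Ux); apply: le_trans (grow _ _ _ (half _ ur) huvpsi Ux).
  rewrite uE mul0r mul0r sube0 leeD2l// lee_fin lerDl.
  by rewrite mulr_ge0 ?divr_ge0 ?sqr_ge0// ltW.
move=> z w; apply: second_subdiff_ge (ltW s0) _.
have [d3 d30 hd3] := subdiff_continuous_lt phiN xbdom cont eps0.
(* A [v'] within [d] of [v] lies within [2 d] of [vb]. The third bound is then what solving the tilt
   by [v'] in the ball of radius [rho / 2] requires, and [d3] yields the level condition. *)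
pose d := Num.min (Num.min (rho / 4) d3) (s * rho / 8).
have d0 : 0 < d by rewrite !lt_min d30 !divr_gt0// mulr_gt0.
have [dr dd3 dsr] : [/\ d <= rho / 4, d <= d3 & d <= s * rho / 8].
  by rewrite /d !ge_min !lexx !orbT.
exists d => // u v z' w' ud vd.
have := @regular_coderivative_ge (limiting_subdiff phi) u v z' w' s d s0 d0 _.
move=> h nrm; apply: h (nrm) => v' v'v.
have /regular_normalP[[[u1 v1] huv /= /eq_row_mx[e1 e2]] _] := nrm.
rewrite /gph/= e1 e2 in huv.
have ulr : enorm (u - xb) < rho by lra.
have vlr : enorm (v - vb) < rho by lra.
have ue : (phi u < phi xb + eps%:E)%E by apply: hd3 huv _ _; lra.
have [huvpsi _] := toPsi _ _ ulr vlr ue huv.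
have v'vb : enorm (v' - vb) < 2 * d by have := enorm_dist3 v v' vb; lra.
have xbpsi : edom psi xb by exact: hvbpsi.1.
have [] := @tilt_solvable _ _ psi xb vb v' s 0 (rho / 2) psiN psilsc xbpsi (lexx 0) _ _ _.
- by rewrite add0r.
- move=> x; rewrite /ecball/= => xr.
  by apply: grow => //; apply: inU; lra.
- by rewrite scale0r add0r add0r; nra.
move=> u'; rewrite !scale0r !add0r subr0 => u'xb huv'.
have u'lr : enorm (u' - xb) < rho by rewrite -(ltr_pM2l s0); nra.
have v'lr : enorm (v' - vb) < rho by lra.
exists u'; first exact: toPhi.
apply: (@subgradients_monotone psi) => //; [exact: huvpsi.1|exact: huv'.1| |].
- by apply: grow => //; exact: inU.
- by apply: grow => //; exact: inU.
Qed.

End VariationalToSecondOrder.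

(** * A mean value inequality for proximal subgradients *)

Section ProximalMeanValue.
Context {R : realType} {n : nat}.
Implicit Types (u v w x y z D : 'rV[R]_n).

(** [M] and [d] may depend on [y] and [z], and [M] may have any sign, which is why [|M|] appears in
    later estimates. *)
Definition prox_subgradient (g : 'rV[R]_n -> R) y z : Prop :=
  exists M d : R, 0 < d /\ forall y', enorm (y' - y) < d ->
    g y + dotv z (y' - y) - M * enorm (y' - y) ^+ 2 <= g y'.

Lemma segment_in_ball x y (t r : R) : 0 <= t -> t <= 1 ->
  enorm x < r -> enorm (x + y) < r -> enorm (x + t *: y) < r.
Proof.
move=> t0 t1 xr xyr.
have -> : x + t *: y = (1 - t) *: x + t *: (x + y).
  by apply/rowP => i; rewrite !mxE; ring.
apply: le_lt_trans (enormD _ _) _.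
rewrite !enormZ ger0_norm ?subr_ge0// ger0_norm//.
by have [h|/ltW h] := leP (enorm x) (enorm (x + y)); nra.
Qed.

(* Minimize [g (a + t D + delta) + M |delta|^2 - c' t] over [t] in [0, 1] and
   small [delta], with [c' < c] and [M] large. The partial minimality in [delta]
   gives the proximal subgradient [- 2 M delta], and moving along [- D] in [t]
   with [a + t D + delta] fixed contradicts [c <= <- 2 M delta, D>] unless [t = 0]. *)
Lemma prox_mean_value (g : 'rV[R]_n -> R) yb a D (rho C c : R) :
  0 <= C ->
  (forall y y', enorm (y - yb) < rho -> enorm (y' - yb) < rho ->
     g y <= g y' + C * enorm (y - y')) ->
  (forall y z, enorm (y - yb) < rho -> prox_subgradient g y z -> c <= dotv z D) ->
  enorm (a - yb) < rho / 2 -> enorm (a + D - yb) < rho / 2 ->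
  g a + c <= g (a + D).
Proof.
move=> C0 lip slope ayb aDyb.
have rho0 : 0 < rho by have := enorm_ge0 (a - yb); lra.
apply: (@le_of_forall_eps _ _ _ 2) => e e0 _.
(* Minimality will give [M |x| <= C]. The first summand then makes [C |x| <= e], and the second
   keeps [x] strictly inside its ball. *)
pose c' := c - e; pose M := (C + 1) ^+ 2 / e + 4 * (C + 1) / rho.
have C1 : 0 < C + 1 by lra.
have M1 : 0 < (C + 1) ^+ 2 / e by rewrite divr_gt0// exprn_gt0.
have M2 : 0 < 4 * (C + 1) / rho by rewrite divr_gt0// mulr_gt0.
have M0 : 0 < M by rewrite addr_gt0.
have CMe : C ^+ 2 <= e * M.
  rewrite /M mulrDr mulrCA mulfV ?gt_eqF// mulr1.
  by have := mulr_gt0 e0 M2; nra.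
have CMrho : C < M * (rho / 4).
  rewrite /M mulrDl.
  have -> : 4 * (C + 1) / rho * (rho / 4) = C + 1 by field; rewrite gt_eqF.
  have : 0 < (C + 1) ^+ 2 / e * (rho / 4) by rewrite mulr_gt0// divr_gt0.
  lra.
clearbody M.
have seg t : 0 <= t -> t <= 1 -> enorm (a + t *: D - yb) < rho / 2.
  by move=> t0 t1; rewrite addrAC; apply: segment_in_ball => //; rewrite addrAC.
pose F (p : R * 'rV[R]_n) := g (a + p.1 *: D + p.2) + M * enorm p.2 ^+ 2 - c' * p.1.
pose K : set (R * 'rV[R]_n) := `[0, 1]%classic `*` ecball 0 (rho / 2).
have KP t x : K (t, x) <-> [/\ 0 <= t, t <= 1 & enorm x <= rho / 2].
  rewrite /K /ecball/= in_itv/= subr0.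
  by split=> [[/andP[]]|[-> ->]].
have inb t x : K (t, x) -> enorm (a + t *: D + x - yb) < rho.
  move=> /KP[t0 t1 xr]; rewrite addrAC.
  by apply: le_lt_trans (enormD _ _) _; have := seg t t0 t1; lra.
have [| |[t x] r Ktx|[t x] Ktx Fmin] := @lsc_compact_min R _ K (fun p => (F p)%:E).
- by apply: compact_setX; [exact: segment_compact|exact: ecball_compact].
- by exists (0, 0); apply/KP; rewrite enorm0 lexx ler01 divr_ge0// ltW.
- rewrite lte_fin => rF.
  pose L := C * (enorm D + 1) + 2 * M * enorm x + `|c'|.
  have L0 : 0 <= L.
    by rewrite /L !addr_ge0 ?mulr_ge0 ?addr_ge0 ?enorm_ge0// ltW.
  have L1 : 0 < L + 1 by lra.
  pose eta := (F (t, x) - r) / (L + 1).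
  have eta0 : 0 < eta by rewrite divr_gt0// subr_gt0.
  exists (ball t eta `*` [set x' | enorm (x' - x) < eta]).
    exists (ball t eta, [set x' | enorm (x' - x) < eta]) => //.
    by split; [exact: nbhsx_ballx|exact: nbhs_enorm_ball].
  move=> [t' x'] /= [tt' xx'] Ktx'; rewrite lte_fin.
  have {}tt' : `|t - t'| < eta by [].
  have := lip _ _ (inb _ _ Ktx) (inb _ _ Ktx').
  have -> : a + t *: D + x - (a + t' *: D + x') = (t - t') *: D + (x - x').
    by apply/rowP => i; rewrite !mxE; ring.
  have := enormD ((t - t') *: D) (x - x'); rewrite enormZ (enormBC x x').
  have sq : enorm x ^+ 2 - 2 * (enorm x * enorm (x' - x)) <= enorm x' ^+ 2.
    have := dotv_ge x (x' - x); have := dotvv_ge0 (x' - x).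
    by rewrite !enorm_sqr !dotvE (dotvC x' x); lra.
  have cc : - (`|c'| * `|t - t'|) <= c' * (t - t').
    by rewrite -normrM lerNl; have := ler_norm (- (c' * (t - t'))); rewrite normrN.
  move=> h1 h2.
  have : eta * (L + 1) = F (t, x) - r by rewrite /eta divfK// gt_eqF.
  rewrite /F/= => etaE.
  have n1 := enorm_ge0 D; have n2 := enorm_ge0 x; have n3 := enorm_ge0 (x' - x).
  have h3 : C * enorm ((t - t') *: D + (x - x')) <= C * (eta * (enorm D + 1)).
    apply: ler_wpM2l => //; apply: le_trans h1 _.
    by have := ler_wpM2r n1 (ltW tt'); lra.
  have h4 := ler_wpM2l (mulr_ge0 (ltW M0) n2) (ltW xx').
  have h5 := ler_wpM2l (normr_ge0 c') (ltW tt').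
  have h6 := ler_wpM2l (ltW M0) sq.
  rewrite /L in etaE; lra.
have {}Fmin t' x' : K (t', x') -> F (t, x) <= F (t', x').
  by move=> /Fmin; rewrite lee_fin.
have /KP[t0 t1 xr] := Ktx.
have K0 : K (t, 0) by apply/KP; rewrite enorm0 divr_ge0// ltW.
have xn := enorm_ge0 x.
have xM : M * enorm x <= C.
  have := Fmin t 0 K0; rewrite /F/= enorm0 addr0.
  have := lip _ _ (inb _ _ K0) (inb _ _ Ktx); rewrite addr0.
  have -> : a + t *: D - (a + t *: D + x) = - x by rewrite opprD addrA subrr sub0r.
  rewrite enormN => h1 h2; have h3 : M * enorm x ^+ 2 <= C * enorm x by lra.
  have [->|x0] := eqVneq (enorm x) 0; first by rewrite mulr0.
  by rewrite -(@ler_pM2r _ (enorm x)) ?lt_def ?x0//; move: h3; rewrite expr2; lra.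
have {}xr : enorm x < rho / 4.
  by rewrite -(ltr_pM2l M0); apply: le_lt_trans xM _.
have slopex : c <= - (2 * M * dotv x D).
  have := slope (a + t *: D + x) (- (2 * M) *: x) (inb _ _ Ktx).
  rewrite dotvZl mulNr; apply.
  exists M, (rho / 4); split; first by rewrite divr_gt0.
  move=> y' y'r; pose h := y' - (a + t *: D + x).
  have := Fmin t (x + h); rewrite /F/=.
  have -> : a + t *: D + (x + h) = y' by rewrite /h addrA [LHS]addrC subrK.
  rewrite -/h in y'r *; have hn := enormD x h.
  have Kxh : K (t, x + h) by apply/KP; split=> //; lra.
  move=> /(_ Kxh).
  have -> : enorm (x + h) ^+ 2 = enorm x ^+ 2 + 2 * dotv x h + enorm h ^+ 2.
    by clearbody h; rewrite !enorm_sqr !dotvE (dotvC h x); ring.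
  rewrite dotvZl; lra.
have t00 : t = 0.
  apply/eqP; rewrite eq_le t0 andbT leNgt; apply/negP => tp.
  have D0 := enorm_ge0 D.
  have D1 : 0 < enorm D + 1 by lra.
  have MD : 0 < M * (enorm D ^+ 2 + 1) by rewrite mulr_gt0// ltr_wpDl// sqr_ge0.
  (* The bounds keep [(t - h, x + h D)] in [K] and make [h M |D|^2] smaller than [e], the gap
     between [c] and [c']. *)
  pose h := Num.min t (Num.min (rho / 4 / (enorm D + 1)) (e / (M * (enorm D ^+ 2 + 1)))).
  have h0 : 0 < h by rewrite !lt_min tp !divr_gt0.
  have [ht hD he] : [/\ h <= t, h * (enorm D + 1) <= rho / 4 &
      h * (M * (enorm D ^+ 2 + 1)) <= e].
    by rewrite -!ler_pdivlMr// /h !ge_min !lexx !orbT.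
  have hD' : enorm (x + h *: D) <= rho / 2.
    by apply: le_trans (enormD _ _) _; rewrite enormZ gtr0_norm//; nra.
  have Kh : K (t - h, x + h *: D) by apply/KP; split=> //; lra.
  have := Fmin _ _ Kh; rewrite /F/=.
  have -> : a + (t - h) *: D + (x + h *: D) = a + t *: D + x.
    by apply/rowP => i; rewrite !mxE; ring.
  have -> : enorm (x + h *: D) ^+ 2 =
      enorm x ^+ 2 + 2 * h * dotv x D + h ^+ 2 * enorm D ^+ 2.
    by clearbody h; rewrite !enorm_sqr !dotvE (dotvC D x); ring.
  move=> h1.
  have : 0 <= h * (2 * M * dotv x D + h * (M * enorm D ^+ 2) + c') by lra.
  rewrite pmulr_rge0// /c'.
  have := mulr_gt0 h0 M0; move: he; lra.
(* Comparing [(0, x)] with [(1, 0)] loses [e] from [c'] and at most [e] from [C |x|], hence the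
   factor 2 above. *)
have K1 : K (1, 0) by apply/KP; rewrite enorm0 ler01 divr_ge0// ltW.
have := Fmin _ _ K1; have := lip _ _ (inb _ _ K0) (inb _ _ Ktx).
rewrite /F/= t00 scale0r scale1r !addr0 enorm0 opprD addrA subrr sub0r enormN.
have : C * enorm x <= e.
  rewrite -(ler_pM2l M0); apply: le_trans (_ : C * C <= _).
    by rewrite mulrCA; apply: ler_wpM2l.
  by rewrite -expr2 [M * e]mulrC.
have : 0 <= M * enorm x ^+ 2 by rewrite mulr_ge0 ?sqr_ge0// ltW.
rewrite /c'; lra.
Qed.

End ProximalMeanValue.

(** * Quadratic growth from positive coderivatives *)

Section QuadraticGrowth.
Context {R : realType} {n : nat}.
Implicit Types (phi : 'rV[R]_n -> \bar R) (u v w x y z D : 'rV[R]_n).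

(* The pairs [(mu z, z - D)] are the normals to the graph expressed through the
   parameter [y = mu u + v], in which bounded [z] and unit [D] form a compact set. *)
Lemma uniform_positive_coderivative phi xb vb (mu L : R) : 0 < mu ->
  limiting_subdiff phi xb vb ->
  (forall z w, second_subdiff phi xb vb w z -> w != 0 -> 0 < dotv z w) ->
  exists2 c : R, 0 < c & forall u v z D,
    enorm (u - xb) < c -> enorm (v - vb) < c ->
    regular_subdiff (indicator_fun [set row_mx p.1 p.2 | p in gph (limiting_subdiff phi)])
      (row_mx u v) (row_mx (mu *: z) (z - D)) ->
    enorm D = 1 -> enorm z <= L -> c <= dotv z D.
Proof.
move=> mu0 hvb posdef; apply: contrapT => noc.
set Omega := [set row_mx p.1 p.2 | p in gph (limiting_subdiff phi)] in noc.
pose P (c : R) (p : 'rV[R]_(n + n)) := exists u v,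
  [/\ enorm (u - xb) < c, enorm (v - vb) < c,
      regular_subdiff (indicator_fun Omega) (row_mx u v)
        (row_mx (mu *: lsubmx p) (lsubmx p - rsubmx p)) &
      [/\ enorm (rsubmx p) = 1, enorm (lsubmx p) <= L & dotv (lsubmx p) (rsubmx p) < c]].
have /choice[f hf] : forall k : nat, exists p, P k.+1%:R^-1 p.
  move=> k; apply: contrapT => nop; apply: noc.
  exists k.+1%:R^-1; first by rewrite invr_gt0 ltr0Sn.
  move=> u v z D u1 v1 nrm D1 zL; rewrite leNgt; apply/negP => zD; apply: nop.
  by exists (row_mx z D), u, v; rewrite row_mxKl row_mxKr.
have [|p [_ pclu]] := @ecball_compact R _ 0 (L + 1) (f @ \oo) _.
  exists 0%N => // k _; rewrite /ecball/= subr0.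
  have [_ [_ [_ _ _ [D1 zL _]]]] := hf k.
  rewrite -[f k]hsubmxK; have [_ _] := enorm_row_mx (lsubmx (f k)) (rsubmx (f k)).
  by rewrite D1; lra.
pose z := lsubmx p; pose D := rsubmx p.
have close (e : R) : 0 < e -> exists u v z' D',
    [/\ enorm (u - xb) < e, enorm (v - vb) < e,
        regular_subdiff (indicator_fun Omega) (row_mx u v) (row_mx (mu *: z') (z' - D')),
        enorm D' = 1 & [/\ dotv z' D' < e, enorm (z' - z) < e & enorm (D' - D) < e]].
  move=> e0; have [N _ hN] := near_infty_natSinv_lt (PosNum e0).
  have [|_ [[k Nk <-] fkp]] := pclu (f @` [set k | (N <= k)%N]) _ _
      (@nbhs_enorm_ball _ _ p e e0).
    by exists N => // k Nk; exists k.
  have [u [v [u1 v1 nrm [D1 zL zD]]]] := hf k.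
  have ke : k.+1%:R^-1 < e := hN k Nk.
  exists u, v, (lsubmx (f k)), (rsubmx (f k)); split=> //; try exact: lt_trans ke.
  have [] := enorm_row_mx (lsubmx (f k) - z) (rsubmx (f k) - D).
  rewrite -add_row_mx -opp_row_mx !hsubmxK => h1 h2 _.
  by split; [exact: lt_trans ke|exact: le_lt_trans fkp|exact: le_lt_trans fkp].
have D0 : D != 0.
  have [|u [v [z' [D' [_ _ _ D1 [_ _ DD]]]]]] := close 2^-1; first by rewrite invr_gt0.
  by apply/eqP => D0; move: DD; rewrite D0 subr0 D1; lra.
have zD : dotv z D <= 0.
  apply: (@le_of_forall_eps _ _ _ (2 + enorm z)) => e e0 _.
  have [u [v [z' [D' [_ _ _ D1 [zD zz DD]]]]]] := close e e0.
  have := dotv_ge (z' - z) D'; rewrite D1 mulr1.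
  have := dotv_ge z (D' - D); have := ler_wpM2l (enorm_ge0 z) (ltW DD).
  by rewrite !dotvE; clearbody z D; lra.
(* The second component [z - D] is read as [- w], so [w = D - z]. *)
have nrm : second_subdiff phi xb vb (D - z) (mu *: z).
  apply/limiting_normalP; rewrite opprB; split; first by exists (xb, vb).
  move=> e e0; have mu2 : 0 < mu + 2 by lra.
  have [|u [v [z' [D' [u1 v1 nrm D1 [_ zz DD]]]]]] := close (e / (mu + 2)).
    by rewrite divr_gt0.
  have e2 : e / (mu + 2) * (mu + 2) = e by rewrite divfK// gt_eqF.
  set d := e / (mu + 2) in u1 v1 zz DD e2.
  have d0 : 0 < d by rewrite divr_gt0.
  have hmu := mulr_gt0 d0 mu0.
  exists (row_mx u v), (row_mx (mu *: z') (z' - D')); split=> //.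
    rewrite opp_row_mx add_row_mx.
    by have [_ _] := enorm_row_mx (u - xb) (v - vb); lra.
  rewrite opp_row_mx add_row_mx -scalerBr.
  have [_ _] := enorm_row_mx (mu *: (z' - z)) (z' - D' - (z - D)).
  rewrite enormZ gtr0_norm//.
  have -> : z' - D' - (z - D) = (z' - z) - (D' - D).
    by apply/rowP => i; rewrite !mxE; ring.
  have := enormB (z' - z) (D' - D); have := ler_wpM2l (ltW mu0) (ltW zz); lra.
(* If [w = 0] then [<z, D> = |D|^2 > 0]; otherwise positive definiteness gives
   [<z, D> > |z|^2 >= 0]. Both contradict [zD]. *)
have [Dz|Dz] := eqVneq (D - z) 0.
  have {}Dz : z = D by apply/esym/eqP; rewrite -subr_eq0 Dz.
  have := enorm_gt0 D0; rewrite -(@ltr_pXn2r _ 2) ?nnegrE ?enorm_ge0// expr0n enorm_sqr/=.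
  by rewrite -{1}Dz; lra.
have := posdef _ _ nrm Dz; rewrite dotvZl pmulr_rgt0//.
by have := dotvv_ge0 z; rewrite dotvDr dotvNr; lra.
Qed.

(** A Riemann sum replaces the integral of the slope [A + B t] over [[0, 1]]: with [N + 1] equal
    steps the quadratic errors add up to [K / (N + 1)], so [theta] need not be differentiable. *)
Lemma discrete_growth (theta : R -> R) (A B K : R) : 0 <= B ->
  (forall t t', 0 <= t -> t <= t' -> t' <= 1 ->
    theta t + (t' - t) * (A + B * t') - K * (t' - t) ^+ 2 <= theta t') ->
  theta 0 + A + B / 2 <= theta 1.
Proof.
move=> B0 step; apply: (@le_of_forall_eps _ _ _ `|K|) => e e0 _.
have [N _ /(_ N (leqnn N))/= Ne] := near_infty_natSinv_lt (PosNum e0).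
set h := N.+1%:R^-1 in Ne.
have h0 : 0 < h by rewrite invr_gt0 ltr0Sn.
have Nh : N.+1%:R * h = 1 by rewrite mulfV// pnatr_eq0.
have ind k : (k <= N.+1)%N ->
    (* The [B] term is the exact value of the sum of [h B (j h)] for [1 <= j <= k]. *)
    theta 0 + A * (k%:R * h) + B / 2 * (k%:R * h) * (k%:R * h + h) - K * h * (k%:R * h) <= theta (k%:R * h).
  elim: k => [_|k IH kN]; first by rewrite !mul0r !mulr0 !mul0r subr0 !addr0.
  have k1 : k.+1%:R * h = k%:R * h + h by rewrite -natr1 mulrDl mul1r.
  have := IH (ltnW kN); have := step (k%:R * h) (k.+1%:R * h).
  rewrite k1 => /(_ (mulr_ge0 (ler0n _ _) (ltW h0))) st.
  have le1 : k%:R * h + h <= 1.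
    have : k.+1%:R * h <= N.+1%:R * h by apply: ler_wpM2r (ltW h0) _ _ _; rewrite ler_nat.
    by rewrite Nh k1.
  have {st} := st _ le1; rewrite lerDl (ltW h0) => /(_ isT).
  move: (k%:R * h) => s; lra.
have := ind N.+1 (leqnn _); rewrite Nh !mulr1.
have := ler_norm K; have := mulr_ge0 B0 (ltW h0).
have := ler_wpM2r (normr_ge0 K) (ltW Ne); have := ler_wpM2r (ltW h0) (ler_norm K).
lra.
Qed.

Definition near_graph phi xb vb (rho : R) u v : Prop :=
  [/\ limiting_subdiff phi u v, enorm (u - xb) <= rho & enorm (v - vb) <= rho].

(** * The resolvent of a prox-regular function and its Moreau envelope *)

Section Resolvent.
Context (phi : 'rV[R]_n -> \bar R) (xb vb : 'rV[R]_n) (r rho : R).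
Context (phiN : forall x, phi x != -oo%E) (philsc : lower_semicontinuous phi).
Context (hvb : limiting_subdiff phi xb vb) (r0 : 0 <= r) (rho0 : 0 < rho).
Context (prox : forall u v x, near_graph phi xb vb rho u v -> enorm (x - xb) <= rho ->
  (phi u + (dotv v (x - u) + - r / 2 * enorm (x - u) ^+ 2)%:E <= phi x)%E).
(** One more than the prox-regularity constant, so that [mu u + v] is strongly monotone along the
    graph with modulus [mu - r = 1]. *)
Let mu := r + 1.
Let mu0 : 0 < mu. Proof. by rewrite ltr_wpDl. Qed.
Let yb := mu *: xb + vb.

Lemma resolvent_nonexpansive u v u' v' :
  near_graph phi xb vb rho u v -> near_graph phi xb vb rho u' v' ->
  enorm (u' - u) <= enorm (mu *: u' + v' - (mu *: u + v)).
Proof.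
move=> hu hu'; have [huv ur _] := hu; have [huv' ur' _] := hu'.
have := subgradients_monotone phiN huv.1 huv'.1 (prox hu ur') (prox hu' ur) => mono.
have [->|n0] := eqVneq (enorm (u' - u)) 0; first exact: enorm_ge0.
rewrite -(@ler_pM2r _ (enorm (u' - u))) ?lt_def ?n0 ?enorm_ge0//.
apply: le_trans (dotv_le _ _).
have -> : mu *: u' + v' - (mu *: u + v) = mu *: (u' - u) + (v' - v).
  by apply/rowP => i; rewrite !mxE; ring.
by rewrite dotvDl dotvZl -enorm_sqr /mu; lra.
Qed.

Lemma resolvent_exists : exists2 d : R, 0 < d & exists P : 'rV[R]_n -> 'rV[R]_n,
  forall y, enorm (y - yb) < d -> near_graph phi xb vb (rho / 2) (P y) (y - mu *: P y).
Proof.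
(* The minimizer lies within [2 d] of [xb] and its subgradient within [d + 2 mu d] of [vb]; both are
   at most [rho / 2], leaving room for neighboring graph points. *)
have mup := mu0; pose d := rho / 2 / (2 + 2 * mu).
have d0 : 0 < d by rewrite !divr_gt0// addr_gt0// mulr_gt0.
have dE : d * (2 + 2 * mu) = rho / 2 by rewrite divfK// gt_eqF// addr_gt0// mulr_gt0.
have dmu := mulr_gt0 d0 mup.
exists d => //; suff /choice[P hP] : forall y, exists u, enorm (y - yb) < d ->
    near_graph phi xb vb (rho / 2) u (y - mu *: u) by exists P.
move=> y; have [yd|] := ltP (enorm (y - yb)) d; last by exists 0.
have [| | |u] := @tilt_solvable R n phi xb vb y (- r) mu rho phiN philsc hvb.1 (ltW mup).
- by rewrite /mu; lra.
- by move=> x xr; apply: prox => //; split=> //; rewrite subrr enorm0 ltW.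
- by rewrite /mu -/yb; move: (mulr_gt0 d0 mup); lra.
have -> : mu - r = 1 by rewrite /mu; ring.
rewrite mul1r -/yb => uxb huv; exists u => _; split=> //; first lra.
have -> : y - mu *: u - vb = (y - yb) - mu *: (u - xb).
  by apply/rowP => i; rewrite /yb !mxE; ring.
apply: le_trans (enormB _ _) _; rewrite enormZ gtr0_norm//.
have : mu * enorm (u - xb) <= mu * (2 * d) by apply: ler_wpM2l; lra.
by lra.
Qed.

Context (d : R) (P : 'rV[R]_n -> 'rV[R]_n) (d0 : 0 < d).
Context (hP : forall y, enorm (y - yb) < d ->
  near_graph phi xb vb (rho / 2) (P y) (y - mu *: P y)).

Let hP' y : enorm (y - yb) < d -> near_graph phi xb vb rho (P y) (y - mu *: P y).
Proof.
have hr : rho / 2 <= rho by rewrite ler_pdivrMr// ler_pMr// ler1n.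
by move=> /hP[h1 h2 h3]; split; [|exact: le_trans h2 hr|exact: le_trans h3 hr].
Qed.

Lemma resolvent_unique u v : near_graph phi xb vb rho u v ->
  enorm (mu *: u + v - yb) < d -> P (mu *: u + v) = u.
Proof.
move=> huv yd; have := resolvent_nonexpansive huv (hP' yd).
rewrite addrCA subrr addr0 subrr enorm0 => h.
by apply/eqP; rewrite -subr_eq0; apply/eqP/enorm_eq0/le_anti; rewrite h enorm_ge0.
Qed.

Lemma resolvent_lipschitz y y' : enorm (y - yb) < d -> enorm (y' - yb) < d ->
  enorm (y' - mu *: P y' - (y - mu *: P y)) <= (1 + mu) * enorm (y' - y).
Proof.
move=> yd yd'; have := resolvent_nonexpansive (hP' yd) (hP' yd').
have yE x : mu *: P x + (x - mu *: P x) = x by rewrite addrCA subrr addr0.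
rewrite !yE => h.
have -> : y' - mu *: P y' - (y - mu *: P y) = (y' - y) - mu *: (P y' - P y).
  by apply/rowP => i; rewrite !mxE; ring.
apply: le_trans (enormB _ _) _; rewrite enormZ gtr0_norm//.
by have := ler_wpM2l (ltW mu0) h; lra.
Qed.

Let g D y := dotv D (y - mu *: P y).

(** A proximal subgradient is bounded by the Lipschitz constant of its function, as a small step
    along [z] itself shows. *)
Lemma prox_subgradient_le D y z : enorm (y - yb) < d ->
  prox_subgradient (g D) y z -> enorm z <= (1 + mu) * enorm D.
Proof.
move=> yd [M [d' [d'0 hd']]].
have [->|z0] := eqVneq (enorm z) 0.
  by rewrite mulr_ge0 ?enorm_ge0// addr_ge0// ltW.
have {}z0 : 0 < enorm z by rewrite lt_def z0 enorm_ge0.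
apply: (@le_of_forall_eps _ _ _ (`|M| * enorm z)) => e e0 e1.
pose t := Num.min e (Num.min d' (d - enorm (y - yb)) / enorm z / 2).
have m0 : 0 < Num.min d' (d - enorm (y - yb)) by rewrite lt_min d'0 subr_gt0.
have t0 : 0 < t by rewrite lt_min e0 !divr_gt0.
have te : t <= e by rewrite /t ge_min lexx.
have tz : t * enorm z < Num.min d' (d - enorm (y - yb)).
  have : t <= Num.min d' (d - enorm (y - yb)) / enorm z / 2.
    by rewrite /t ge_min lexx orbT.
  rewrite mulrAC ler_pdivlMr// => h.
  by apply: le_lt_trans h _; lra.
move: tz; rewrite lt_min => /andP[tz1 tz2].
have yz : y + t *: z - y = t *: z by rewrite addrAC subrr add0r.
have yz2 : enorm (y + t *: z - yb) < d.
  rewrite addrAC; apply: le_lt_trans (enormD _ _) _.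
  by rewrite enormZ gtr0_norm//; lra.
have := hd' (y + t *: z); rewrite yz enormZ gtr0_norm// => /(_ tz1).
have := resolvent_lipschitz yd yz2; rewrite yz enormZ gtr0_norm// => lip.
have := dotv_le D (y + t *: z - mu *: P (y + t *: z) - (y - mu *: P y)).
rewrite dotvDr dotvNr -!/(g D _) => h1; rewrite dotvZr -enorm_sqr => h2.
have h3 := ler_wpM2l (enorm_ge0 D) lip.
have h4 : t * enorm z * enorm z <= t * enorm z * ((1 + mu) * enorm D + M * t * enorm z).
  by move: h1 h2 h3; rewrite !expr2; lra.
have {h4} : enorm z <= (1 + mu) * enorm D + M * t * enorm z.
  by move: h4; rewrite ler_pM2l// mulr_gt0.
have : M * t * enorm z <= e * (`|M| * enorm z).
  rewrite mulrA; apply: ler_wpM2r (ltW z0) _ _ _.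
  have := ler_wpM2r (ltW t0) (ler_norm M); have := ler_wpM2r (normr_ge0 M) te; lra.
lra.
Qed.

(** Every nearby graph point is reached by [P], so the proximal inequality can be written at
    [y' = mu u + v]. Its linear part is the pairing of [(mu z, z - D)] with the graph displacement,
    and its quadratic error is negligible. *)
Lemma prox_subgradient_normal D y z : enorm (y - yb) < d ->
  prox_subgradient (g D) y z ->
  regular_subdiff (indicator_fun [set row_mx p.1 p.2 | p in gph (limiting_subdiff phi)])
    (row_mx (P y) (y - mu *: P y)) (row_mx (mu *: z) (z - D)).
Proof.
move=> yd [M [d' [d'0 hd']]]; have [hy yr vr] := hP yd.
apply/regular_normalP; split; first by exists (P y, y - mu *: P y).
move=> e e0; have mu1 : 0 < mu + 1 by rewrite addr_gt0.
have M1 : 0 < (`|M| + 1) * (mu + 1) ^+ 2.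
  by rewrite mulr_gt0 ?exprn_gt0// ltr_wpDl.
pose m := Num.min (Num.min d' (d - enorm (y - yb))) (rho / 2).
have m0 : 0 < m by rewrite !lt_min d'0 subr_gt0 yd divr_gt0.
have [md' md'' mrho] : [/\ m <= d', m <= d - enorm (y - yb) & m <= rho / 2].
  by rewrite /m !ge_min !lexx !orbT.
clearbody m.
(* The bounds in turn keep [(u, v)] in the localized graph, keep [y'] within [m] of [y], and absorb
   the quadratic error into [e |q|]. *)
exists (Num.min (Num.min m (m / (mu + 1))) (e / ((`|M| + 1) * (mu + 1) ^+ 2))).
  by rewrite !lt_min m0 !divr_gt0.
move=> _ [[u v] /= huv <-]; rewrite opp_row_mx add_row_mx !lt_min.
set v0 := y - mu *: P y in vr *.
set q := row_mx (u - P y) (v - v0) => /andP[/andP[qm qm'] qe].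
have [uq vq _] := enorm_row_mx (u - P y) (v - v0); rewrite -/q in uq vq.
have ng : near_graph phi xb vb rho u v.
  split=> //.
    by have := enorm_dist3 (P y) u xb; lra.
  by have := enorm_dist3 v0 v vb; lra.
pose y' := mu *: u + v.
have yy : y' - y = mu *: (u - P y) + (v - v0).
  by apply/rowP => i; rewrite /y' /v0 !mxE; ring.
have yq : enorm (y' - y) <= (mu + 1) * enorm q.
  rewrite yy; apply: le_trans (enormD _ _) _; rewrite enormZ gtr0_norm//.
  by have := ler_wpM2l (ltW mu0) uq; lra.
have ym : enorm (y' - y) < m.
  by apply: le_lt_trans yq _; rewrite mulrC -ltr_pdivlMr.
have yd1 : enorm (y' - yb) < d by have := enorm_dist3 y y' yb; lra.
have := hd' y' (lt_le_trans ym md'); rewrite /g (resolvent_unique ng yd1).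
have -> : y' - mu *: u = v by rewrite /y' addrAC subrr add0r.
rewrite -/v0 => hprox.
have : dotv z (y' - y) - dotv D (v - v0) <= `|M| * enorm (y' - y) ^+ 2.
  have := ler_wpM2r (sqr_ge0 (enorm (y' - y))) (ler_norm M).
  by move: hprox; rewrite [dotv D (v - v0)]dotvDr dotvNr; lra.
have -> : dotv z (y' - y) - dotv D (v - v0) = dotv (row_mx (mu *: z) (z - D)) q.
  by rewrite dotv_row_mx yy; clearbody v0; rewrite !dotvE; ring.
move=> h; apply: le_trans h _.
have qn := enorm_ge0 q; have yn := enorm_ge0 (y' - y).
have y2 : enorm (y' - y) ^+ 2 <= ((mu + 1) * enorm q) ^+ 2.
  by rewrite lerXn2r// nnegrE// mulr_ge0// ltW.
apply: le_trans (ler_wpM2l (normr_ge0 M) y2) _.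
have {}qe : enorm q * ((`|M| + 1) * (mu + 1) ^+ 2) <= e by rewrite -ler_pdivlMr// ltW.
have := ler_wpM2r qn qe; have := mulr_ge0 (sqr_ge0 (mu + 1)) (sqr_ge0 (enorm q)).
by rewrite exprMn; lra.
Qed.

(** The direction [D = (b - a) / |b - a|] is frozen and the mean value inequality is applied to
    [g D] from [a] to [b]: its proximal subgradients satisfy [<z, D> >= c]. *)
Lemma resolvent_strongly_monotone (c : R) : 0 < c ->
  (forall u v z D, enorm (u - xb) < c -> enorm (v - vb) < c ->
    regular_subdiff (indicator_fun [set row_mx p.1 p.2 | p in gph (limiting_subdiff phi)])
      (row_mx u v) (row_mx (mu *: z) (z - D)) ->
    enorm D = 1 -> enorm z <= 1 + mu -> c <= dotv z D) ->
  exists2 d' : R, 0 < d' <= d & forall a b, enorm (a - yb) < d' -> enorm (b - yb) < d' ->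
    c * enorm (b - a) ^+ 2 <= dotv ((b - mu *: P b) - (a - mu *: P a)) (b - a).
Proof.
move=> c0 coder; have mup := mu0; have mu1 : 0 < 1 + mu by rewrite addr_gt0.
(* By the Lipschitz bounds this puts the graph points within [c] of [(xb, vb)]. The radius is halved
   afterwards because the mean value inequality wants its endpoints in the half ball. *)
pose d1 := Num.min d (c / (1 + mu)).
have d10 : 0 < d1 by rewrite lt_min d0 divr_gt0.
have d1d : d1 <= d by rewrite /d1 ge_min lexx.
have d1c : d1 * (1 + mu) <= c by rewrite -ler_pdivlMr// /d1 ge_min lexx orbT.
clearbody d1; exists (d1 / 2); first by rewrite divr_gt0//=; lra.
have ybd : enorm (yb - yb) < d by rewrite subrr enorm0.
have ngb : near_graph phi xb vb rho xb vb by split; rewrite ?subrr ?enorm0 ?ltW.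
have PE : P yb = xb := resolvent_unique ngb ybd.
have QE : yb - mu *: P yb = vb by rewrite PE /yb addrAC subrr add0r.
have near y : enorm (y - yb) < d1 -> enorm (P y - xb) < c /\ enorm (y - mu *: P y - vb) < c.
  move=> yd1; have yd := lt_le_trans yd1 d1d.
  have := resolvent_nonexpansive ngb (hP' yd); have := resolvent_lipschitz ybd yd.
  rewrite QE; have -> : mu *: P y + (y - mu *: P y) = y by rewrite addrCA subrr addr0.
  rewrite -/yb; have := mulr_ge0 (ltW mup) (enorm_ge0 (y - yb)).
  by have := mulr_gt0 mup d10; move=> *; split; nra.
move=> a b ad bd; have [->|ab] := eqVneq b a.
  by rewrite !subrr enorm0 expr0n mulr0 dotv0r.
have N0 : 0 < enorm (b - a) by rewrite enorm_gt0// subr_eq0.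
pose D := (enorm (b - a))^-1 *: (b - a).
have D1 : enorm D = 1.
  by rewrite enormZ gtr0_norm ?invr_gt0// mulVf// gt_eqF.
have DE : b - a = enorm (b - a) *: D by rewrite scalerA mulfV ?scale1r// gt_eqF.
clearbody D; suff : g D a + c * enorm (b - a) <= g D (a + (b - a)).
  rewrite [a + _]addrC subrK /g => h.
  have -> : dotv (b - mu *: P b - (a - mu *: P a)) (b - a) =
      enorm (b - a) * (dotv D (b - mu *: P b) - dotv D (a - mu *: P a)).
    by rewrite [in LHS]DE dotvZr dotvC dotvDr dotvNr.
  by rewrite expr2 mulrCA; apply: ler_wpM2l (ltW N0) _ _ _; lra.
apply: (@prox_mean_value _ _ _ yb a _ d1 (1 + mu)); first exact: ltW.
- move=> y y' yd yd'; have := resolvent_lipschitz (lt_le_trans yd' d1d) (lt_le_trans yd d1d).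
  have := dotv_le D (y - mu *: P y - (y' - mu *: P y')).
  by rewrite D1 mul1r dotvDr dotvNr /g; lra.
- move=> y z yd hz; have yd' := lt_le_trans yd d1d; have [h1 h2] := near y yd.
  rewrite [in leRHS]DE dotvZr mulrC; apply: ler_wpM2l; first exact: ltW.
  have := prox_subgradient_le yd' hz; rewrite D1 mulr1.
  exact: coder h1 h2 (prox_subgradient_normal yd' hz) D1.
- by [].
- by rewrite [a + _]addrC subrK.
Qed.

(* With [y_t = y + t mu (x - u)], the Moreau envelope along the segment is
   [theta t = phi (u_t) + |v_t|^2 / (2 mu)], of slope [<v_t, x - u>]. *)
Lemma resolvent_quadratic_growth (c d' : R) : 0 < c -> 0 < d' <= d ->
  (forall a b, enorm (a - yb) < d' -> enorm (b - yb) < d' ->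
    c * enorm (b - a) ^+ 2 <= dotv ((b - mu *: P b) - (a - mu *: P a)) (b - a)) ->
  exists2 delta : R, 0 < delta & forall u v x, limiting_subdiff phi u v ->
    enorm (u - xb) < delta -> enorm (v - vb) < delta -> enorm (x - xb) < delta ->
    (phi u + (dotv v (x - u) + c * mu / 2 * enorm (x - u) ^+ 2)%:E <= phi x)%E.
Proof.
move=> c0 /andP[d'0 d'd] mono; have mup := mu0.
pose delta := Num.min rho (d' / (1 + 3 * mu)).
have mu3 : 0 < 1 + 3 * mu by rewrite addr_gt0// mulr_gt0.
have delta0 : 0 < delta by rewrite lt_min rho0 divr_gt0.
have [dr dd] : delta <= rho /\ delta * (1 + 3 * mu) <= d'.
  by rewrite -ler_pdivlMr// /delta !ge_min !lexx !orbT.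
clearbody delta; exists delta => // u v x huv ur vr xr.
have ng : near_graph phi xb vb rho u v by split=> //; lra.
pose D := x - u.
have Dr : enorm D <= 2 * delta.
  by have := enorm_dist3 xb x u; rewrite (enormBC xb u) /D; lra.
pose y (t : R) := mu *: u + v + (t * mu) *: D.
have yd (t : R) : 0 <= t -> t <= 1 -> enorm (y t - yb) < d'.
  move=> t0 t1; have -> : y t - yb = mu *: (u - xb) + (v - vb) + (t * mu) *: D.
    by apply/rowP => i; rewrite /y /yb !mxE; ring.
  apply: le_lt_trans (enormD _ _) _; have := enormD (mu *: (u - xb)) (v - vb).
  rewrite !enormZ (gtr0_norm mup) ger0_norm; last by rewrite mulr_ge0// ltW.
  have := ler_wpM2l (ltW mup) (ltW ur).
  have : t * mu * enorm D <= mu * (2 * delta).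
    apply: ler_pM => //; rewrite ?enorm_ge0 ?mulr_ge0 ?(ltW mup)//.
    by rewrite ler_piMl// ltW.
  lra.
pose U t := P (y t); pose W t := y t - mu *: U t.
have ngt (t : R) : 0 <= t -> t <= 1 -> near_graph phi xb vb rho (U t) (W t).
  by move=> t0 t1; apply: hP'; apply: lt_le_trans (yd t t0 t1) d'd.
have y0 : y 0 = mu *: u + v by rewrite /y mul0r scale0r addr0.
have U0 : U 0 = u.
  rewrite /U y0; apply: resolvent_unique ng _.
  by rewrite -y0; apply: lt_le_trans (yd 0 _ _) d'd.
have W0 : W 0 = v by rewrite /W U0 y0 addrAC subrr add0r.
have Wdist t t' : W t' = W t + mu *: ((t' - t) *: D - (U t' - U t)).
  by apply/rowP => i; rewrite /W /y !mxE; ring.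
have fin (t : R) : 0 <= t -> t <= 1 -> phi (U t) = (fine (phi (U t)))%:E.
  move=> t0 t1; have [[+ _] _ _] := ngt t t0 t1; have := phiN (U t).
  by rewrite /edom/=; case: (phi _).
pose theta t := fine (phi (U t)) + (2 * mu)^-1 * enorm (W t) ^+ 2.
have WE t t' : (2 * mu)^-1 * enorm (W t') ^+ 2 = (2 * mu)^-1 * enorm (W t) ^+ 2 +
   dotv (W t) ((t' - t) *: D - (U t' - U t)) +
   mu / 2 * enorm ((t' - t) *: D - (U t' - U t)) ^+ 2.
  rewrite (Wdist t t'); move: ((t' - t) *: D - (U t' - U t)) (W t) => E w.
  rewrite !enorm_sqr !dotvE (dotvC E w) invfM; field; exact: lt0r_neq0.
have := @discrete_growth theta (dotv v D) (c * mu * enorm D ^+ 2) (mu / 2 * enorm D ^+ 2).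
have cD : 0 <= c * mu * enorm D ^+ 2.
  by apply: mulr_ge0 (sqr_ge0 _); apply: mulr_ge0; apply: ltW.
move=> /(_ cD) growth.
have {}growth : theta 0 + dotv v D + c * mu * enorm D ^+ 2 / 2 <= theta 1.
  apply: growth => t t' t0 tt' t1.
  have t'0 := le_trans t0 tt'; have tt1 := le_trans tt' t1.
  have [_ U'r _] := ngt t' t'0 t1.
  have := prox (ngt t t0 tt1) U'r; rewrite (fin t)// (fin t')// -EFinD lee_fin => hprox.
  (* Strong monotonicity between parameters 0 and [t'], divided by [t' mu]. *)
  have slope : dotv v D + c * mu * enorm D ^+ 2 * t' <= dotv (W t') D.
    have [->|t'n] := eqVneq t' 0; first by rewrite mulr0 addr0 W0.
    have tp : 0 < t' * mu by rewrite mulr_gt0// lt_def t'n.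
    have := mono _ _ (yd 0 (lexx _) ler01) (yd t' t'0 t1).
    rewrite -/(U 0) -/(U t') -/(W 0) -/(W t') W0.
    have -> : y t' - y 0 = (t' * mu) *: D.
      by rewrite /y mul0r scale0r addr0 addrAC subrr add0r.
    rewrite enormZ gtr0_norm// dotvZr exprMn.
    have -> : c * ((t' * mu) ^+ 2 * enorm D ^+ 2) =
      (t' * mu) * (c * mu * enorm D ^+ 2 * t') by ring.
    by rewrite ler_pM2l// dotvDl dotvNl; lra.
  have := ler_wpM2l (_ : 0 <= t' - t) slope; rewrite subr_ge0 => /(_ tt').
  rewrite /theta (WE t t') (Wdist t t').
  move: hprox; move: (U t' - U t) (W t) => E w.
  (* The terms in [E = U t' - U t] combine to [(mu - r) / 2 |E|^2 >= 0]; what remains of the error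
     is [mu / 2 (t' - t)^2 |D|^2]. *)
  have : r * dotv E E <= mu * dotv E E.
    by apply: ler_wpM2r (dotvv_ge0 E) _ _ _; rewrite lerDl.
  clearbody D; rewrite !enorm_sqr !dotvE (dotvC E D); lra.
(* Since [W 1 = v + mu (x - U 1)], prox-regularity at [U 1] gives
   [theta 1 - |v|^2 / (2 mu) <= phi x], which transfers the growth of [theta] to [phi]. *)
have [_ U1r _] := ngt 1 ler01 (lexx _).
have xrho : enorm (x - xb) <= rho by lra.
have := prox (ngt 1 ler01 (lexx _)) xrho; rewrite (fin 1) ?ler01// => hx.
apply: le_trans hx; move: growth; rewrite /theta (WE 0 1) U0 W0 subr0 scale1r.
have -> : W 1 = v + mu *: (D - (U 1 - u)) by rewrite (Wdist 0 1) U0 W0 subr0 scale1r.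
have -> : x - U 1 = D - (U 1 - u) by apply/rowP => i; rewrite /D !mxE; ring.
have := fin 0 (lexx _) ler01; rewrite U0 => ->; rewrite -!EFinD lee_fin.
rewrite -/D; move: (D - (U 1 - u)) => E.
have : r * dotv E E <= mu * dotv E E.
  by apply: ler_wpM2r (dotvv_ge0 E) _ _ _; rewrite lerDl.
clearbody D; rewrite !enorm_sqr !dotvE; lra.
Qed.

End Resolvent.
End QuadraticGrowth.

(** * Variational strong convexity from quadratic growth *)

Section VariationalConvexity.
Context {R : realType} {n : nat}.
Implicit Types (phi psi : 'rV[R]_n -> \bar R) (u v w x y z : 'rV[R]_n).

Lemma convex_enorm_ball x (d : R) : convex_set [set y | enorm (y - x) < d].
Proof.
apply/convex_setW => y z; rewrite !inE/= => yd zd k k0 k1; rewrite inE/=.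
suff : enorm (k%:num *: (y : 'rV[R]_n) + (1 - k%:num) *: (z : 'rV[R]_n) - x) < d by [].
have -> : k%:num *: (y : 'rV[R]_n) + (1 - k%:num) *: (z : 'rV[R]_n) - x =
    (z - x) + k%:num *: ((y - x) - (z - x)).
  by apply/rowP => i; rewrite !mxE; ring.
apply: segment_in_ball => //.
by rewrite [X in enorm X]addrC subrK.
Qed.

Lemma subgradient_growth_limiting psi u v (s : R) :
  (forall x, psi x != -oo%E) -> 0 <= s -> edom psi u ->
  (forall x, (psi u + (dotv v (x - u) + s / 2 * enorm (x - u) ^+ 2)%:E <= psi x)%E) ->
  limiting_subdiff psi u v.
Proof.
move=> psiN s0 udom grow; apply: regular_limiting => //; apply/regular_subdiffP => //.
split=> // e e0; exists 1 => // x _; apply: le_trans (grow x).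
rewrite leeD2l// lee_fin lerD2l; apply: le_trans (_ : 0 <= _).
  by rewrite oppr_le0 mulr_ge0 ?enorm_ge0// ltW.
by rewrite mulr_ge0 ?divr_ge0 ?sqr_ge0.
Qed.

Definition quadratic_hull phi (G : set ('rV[R]_n * 'rV[R]_n)) (s : R) x : \bar R :=
  ereal_sup [set (phi p.1 + (dotv p.2 (x - p.1) + s / 2 * enorm (x - p.1) ^+ 2)%:E)%E | p in G].

Lemma quadratic_hull_ge phi G (s : R) u v x : G (u, v) ->
  (phi u + (dotv v (x - u) + s / 2 * enorm (x - u) ^+ 2)%:E <= quadratic_hull phi G s x)%E.
Proof. by move=> Guv; apply: ereal_sup_ubound; exists (u, v). Qed.

Lemma quadratic_hull_lsc phi G (s : R) : 0 <= s ->
  (forall x, phi x != -oo%E) -> (forall p, G p -> edom phi p.1) ->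
  lower_semicontinuous (quadratic_hull phi G s).
Proof.
move=> s0 phiN Gdom x a /ereal_sup_gt[_ [[u v] Guv <-]] /=.
have := phiN u; have := Gdom _ Guv; rewrite /edom/=.
case phiu : (phi u) => [b| |]// _ _; rewrite -EFinD lte_fin => ax.
pose q y := b + (dotv v (y - u) + s / 2 * enorm (y - u) ^+ 2).
pose c := enorm (v + s *: (x - u)) + 1.
have c0 : 0 < c by rewrite ltr_wpDl// enorm_ge0.
exists [set y | enorm (y - x) < (q x - a) / c].
  by apply: nbhs_enorm_ball; rewrite divr_gt0// subr_gt0.
move=> y /=; rewrite ltr_pdivlMr// => yx.
apply: lt_le_trans (quadratic_hull_ge phi s y Guv); rewrite phiu -EFinD lte_fin -/(q y).
have -> : q y = q x + dotv (v + s *: (x - u)) (y - x) + s / 2 * enorm (y - x) ^+ 2.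
  by rewrite /q !enorm_sqr !dotvE (dotvC y x) (dotvC y u) (dotvC u x); field.
have := dotv_ge (v + s *: (x - u)) (y - x); have := enorm_ge0 (y - x).
have := mulr_ge0 s0 (sqr_ge0 (enorm (y - x))).
by move: yx; rewrite /c; lra.
Qed.

(** Subtracting [s / 2 |x|^2] makes every member of the family affine, and a supremum of affine
    functions is convex. *)
Lemma quadratic_hull_strongly_convex phi G (s : R) U : 
  (forall x, phi x != -oo%E) -> (forall p, G p -> edom phi p.1) -> G !=set0 ->
  strongly_convex_on U s (quadratic_hull phi G s).
Proof.
move=> phiN Gdom [[u0 v0] G0] x y t _ _ t0 t1; set z := _ + _.
have hullN x' : quadratic_hull phi G s x' != -oo%E.
  rewrite -ltNye; apply: lt_le_trans (quadratic_hull_ge phi s x' G0).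
  by have := phiN u0; have := Gdom _ G0; rewrite /edom/=; case: (phi u0) => // a _ _; rewrite -EFinD ltNyr.
have t1' : 0 < 1 - t by rewrite subr_gt0.
have ub x' p b : G p -> quadratic_hull phi G s x' = b%:E -> exists2 a : R, phi p.1 = a%:E &
    a + (dotv p.2 (x' - p.1) + s / 2 * enorm (x' - p.1) ^+ 2) <= b.
  case: p => u v Guv hE; have := quadratic_hull_ge phi s x' Guv; rewrite hE.
  have := phiN u; have := Gdom _ Guv; rewrite /edom/=.
  by case: (phi u) => // a _ _; rewrite -EFinD lee_fin; exists a.
have := hullN x; have := hullN y.
case hx : (quadratic_hull phi G s x) => [bx| |]//; last first.
  case: (quadratic_hull phi G s y) => [c| |]// _ _;
  by rewrite /= ?addye ?gt0_muley ?lte_fin// leey.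
case hy : (quadratic_hull phi G s y) => [b| |]// _ _; last first.
  by rewrite /= gt0_muley ?lte_fin// addey// leey.
rewrite leeBlDr// -!EFinM -!EFinD; apply: ge_ereal_sup => _ [p Gp <-].
have [a pa xa] := ub _ _ _ Gp hx; have [a' pa' ya] := ub _ _ _ Gp hy.
move: pa'; rewrite pa => -[aa]; rewrite -aa in ya; rewrite -EFinD lee_fin.
move: p.1 p.2 xa ya {Gp pa} => u v xa ya.
have := ler_wpM2l (ltW t0) xa; have := ler_wpM2l (ltW t1') ya.
rewrite /z !enorm_sqr !dotvE (dotvC u x) (dotvC u y) (dotvC y x); lra.
Qed.

(** The growth hypothesis makes the hull agree with [phi] at the base points and keeps their
    subgradients. Conversely, for a subgradient [v] of the hull at [u], tilting [phi] by [v]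
    produces a graph point [(u', v)] of [phi], hence of the hull, and strong monotonicity forces
    [u = u']. *)
Lemma quadratic_growth_variational phi xb vb (s delta : R) :
  (forall x, phi x != -oo%E) -> lower_semicontinuous phi ->
  limiting_subdiff phi xb vb -> subdiff_continuous phi xb vb ->
  0 < s -> 0 < delta ->
  (forall u v x, limiting_subdiff phi u v ->
    enorm (u - xb) < delta -> enorm (v - vb) < delta -> enorm (x - xb) < delta ->
    (phi u + (dotv v (x - u) + s / 2 * enorm (x - u) ^+ 2)%:E <= phi x)%E) ->
  variationally_strongly_convex phi xb vb s.
Proof.
move=> phiN philsc hvb cont s0 delta0 grow.
pose G := [set p | [/\ limiting_subdiff phi p.1 p.2, enorm (p.1 - xb) < delta &
                       enorm (p.2 - vb) < delta]].
have Gb : G (xb, vb) by split=> //=; rewrite subrr enorm0.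
have Gdom p : G p -> edom phi p.1 by case=> -[].
pose psi := quadratic_hull phi G s.
have psile x : enorm (x - xb) < delta -> (psi x <= phi x)%E.
  by move=> xr; apply: ge_ereal_sup => _ [[u v] [huv ur vr] <-]; exact: grow.
have psiN x : psi x != -oo%E.
  rewrite -ltNye; apply: lt_le_trans (quadratic_hull_ge phi s x Gb).
  have := phiN xb; have := Gdom _ Gb; rewrite /edom/=.
  by case: (phi xb) => // a _ _; rewrite -EFinD ltNyr.
have psiE u v : G (u, v) -> psi u = phi u.
  move=> Guv; have [_ ur _] := Guv; apply/le_anti; rewrite psile//=.
  have := quadratic_hull_ge phi s u Guv.
  by rewrite subrr dotv0r enorm0 expr0n mulr0 addr0 adde0.
have psiG u v : G (u, v) -> limiting_subdiff psi u v.
  move=> Guv; apply: (@subgradient_growth_limiting _ _ _ s) => //; first exact: ltW.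
    by rewrite /edom/= (psiE _ _ Guv); exact: Gdom Guv.
  by move=> x; rewrite (psiE _ _ Guv); exact: quadratic_hull_ge.
have cvx U : strongly_convex_on U s psi.
  by apply: quadratic_hull_strongly_convex => //; exists (xb, vb).
have mono u v x : limiting_subdiff psi u v ->
    (psi u + (dotv v (x - u) + s / 2 * enorm (x - u) ^+ 2)%:E <= psi x)%E.
  move=> huv; apply: strong_limiting_subgradient (ltW s0) (cvx setT) _ _ huv => //.
  exact: filterT.
have [d3 d30 hd3] := subdiff_continuous_lt phiN hvb.1 cont ltr01.
pose d := Num.min delta d3; have d0 : 0 < d by rewrite lt_min delta0.
have [dd dd3] : d <= delta /\ d <= d3 by rewrite /d !ge_min !lexx !orbT.
(* The second bound is what solving the tilt in the ball of radius [delta / 2] requires. *)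
clearbody d; pose d' := Num.min d (s * delta / 4).
have d'0 : 0 < d' by rewrite lt_min d0 divr_gt0// mulr_gt0.
have [d'd d's] : d' <= d /\ d' <= s * delta / 4 by rewrite /d' !ge_min !lexx !orbT.
clearbody d'.
exists [set x | enorm (x - xb) < d], [set v | enorm (v - vb) < d']; split.
  by split; [exact: nbhs_enorm_ball|exact: nbhs_enorm_ball|exact: convex_enorm_ball|exact: convex_enorm_ball].
exists psi, 1; split.
  split=> //.
  - split=> //; exists xb; apply: le_lt_trans hvb.1; apply: psile.
    by rewrite subrr enorm0.
  - exact: quadratic_hull_lsc (ltW s0) phiN Gdom.
  - by move=> x /= xd; apply: psile; lra.
have GP u v : enorm (u - xb) < d -> enorm (v - vb) < d' -> limiting_subdiff phi u v ->
  G (u, v) by move=> ud vd huv; split=> //=; lra.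
split=> //; last first.
  by move=> u v [[[ud _] vd] huv]; rewrite (psiE u v)//; exact: GP.
apply/seteqP; split=> -[u v] /= [[ud vd] huv].
  by case: ud => ud _; split=> //; apply: psiG; exact: GP.
have [|x xd||u'] := @tilt_solvable R n phi xb vb v s 0 (delta / 2) phiN philsc hvb.1 (lexx 0).
- by rewrite add0r.
- by apply: grow => //; rewrite ?subrr ?enorm0//; move: xd; rewrite /ecball/=; lra.
- by rewrite scale0r !add0r; lra.
rewrite !scale0r !add0r subr0 => u'xb hu'v.
have u'd : enorm (u' - xb) < delta by rewrite -(ltr_pM2l s0); nra.
have Gu' : G (u', v) by split=> //=; lra.
have hpsi' := psiG _ _ Gu'.
have := subgradients_monotone psiN huv.1 hpsi'.1 (mono _ _ u' huv) (mono _ _ u hpsi').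
rewrite subrr dotv0l pmulr_rle0// => uu.
have E : u = u'.
  apply/esym/eqP; rewrite -subr_eq0; apply/eqP/dotvv_eq0/le_anti.
  by rewrite dotvv_ge0 -enorm_sqr uu.
rewrite -E in hu'v; split=> //; split=> //; split=> //.
by apply: hd3 hu'v _ _; lra.
Qed.

End VariationalConvexity.

(** * Localized prox-regularity and the equivalence *)

Lemma prox_regular_near {R : realType} {n : nat} (phi : 'rV[R]_n -> \bar R) xb vb :
  (forall x, phi x != -oo%E) -> edom phi xb ->
  subdiff_continuous phi xb vb -> prox_regular phi xb vb ->
  exists r rho : R, [/\ 0 <= r, 0 < rho & forall u v x,
    near_graph phi xb vb rho u v -> enorm (x - xb) <= rho ->
    (phi u + (dotv v (x - u) + - r / 2 * enorm (x - u) ^+ 2)%:E <= phi x)%E].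
Proof.
move=> phiN xbdom cont [eps [r [eps0 r0 prox]]].
have [d d0 hd] := subdiff_continuous_lt phiN xbdom cont eps0.
exists r, (Num.min eps d); split=> //; first by rewrite lt_min eps0.
move=> u v x []; rewrite !le_min => huv /andP[u1 u2] /andP[v1 v2] /andP[x1 _].
have := prox x u v x1 (conj huv (conj u1 v1)) (hd u v huv u2 v2).
by rewrite EFinD addeA mulNr mulNr EFinN.
Qed.

Unset Implicit Arguments.
Set Strict Implicit.

Theorem theorem5p6 (R : realType) (n : nat) (phi : 'rV[R]_n -> \bar R)
    (xbar vbar : 'rV[R]_n)
    (hproper : eproper phi)
    (hlsc : lower_semicontinuous phi)
    (hxbar : edom phi xbar)
    (hvbar : limiting_subdiff phi xbar vbar)
    (hcont : subdiff_continuous phi xbar vbar) :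
  (exists2 sigma : R, 0 < sigma &
     variationally_strongly_convex phi xbar vbar sigma)
  <->
  (prox_regular phi xbar vbar /\
   forall z w : 'rV[R]_n,
     second_subdiff phi xbar vbar w z -> w != 0 -> 0 < dotv z w).
Proof.
have [phiN _] := hproper; split=> [[sigma sigma0 vsc]|[prox posdef]].
  have [prox coder] := variational_second_order hproper hxbar hvbar hcont sigma0 vsc.
  split=> // z w /coder zw w0; apply: lt_le_trans zw.
  by rewrite mulr_gt0// -enorm_sqr exprn_gt0// enorm_gt0.
have [r [rho [r0 rho0 proxr]]] := prox_regular_near phiN hxbar hcont prox.
have mu0 : 0 < r + 1 by rewrite ltr_wpDl.
(* The bound [1 + mu] is the Lipschitz constant of [y - mu P y], which limits proximal subgradients
   for unit [D]. *)
have [c c0 coder] := uniform_positive_coderivative (1 + (r + 1)) mu0 hvbar posdef.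
have [d d0 [P hP]] := resolvent_exists phiN hlsc hvbar r0 rho0 proxr.
have [d' d'd mono] := resolvent_strongly_monotone phiN hvbar r0 rho0 proxr d0 hP c0 coder.
have [delta delta0 grow] := resolvent_quadratic_growth phiN r0 rho0 proxr hP c0 d'd mono.
exists (c * (r + 1)); first exact: mulr_gt0.
apply: (quadratic_growth_variational phiN hlsc hvbar hcont _ delta0) => //.
exact: mulr_gt0.
Qed.
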